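(* Let $n\ge 1$, let $a_k,b_k,c_k$, $k=1,\dots,n$, be real numbers with $b_k\neq 0$ for every $k$, and let $\alpha\in(-\infty,-1/2)$. If the function $f:\mathbb{R}\to\mathbb{R}$, $$f(x)=\sum_{k=1}^{n}c_{k}\bigl[(x-a_{k})^{2}+b_{k}^{2}\bigr]^{\alpha},$$ is not identically zero, then $f$ has no more than $4n-2$ critical points (i.e. points $x\in\mathbb{R}$ with $f'(x)=0$). *)

(* Defs.v *)
From HB Require Import structures.
From mathcomp Require Import all_boot all_order all_algebra.
From mathcomp Require Import all_classical all_reals all_analysis.

Set Implicit Arguments.
Unset Strict Implicit.
Unset Printing Implicit Defensive.

Import Order.TTheory GRing.Theory Num.Theory.
Import numFieldNormedType.Exports.

Local Open Scope ring_scope.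
Local Open Scope classical_set_scope.

(* As [b k != 0], every base is positive, so [powR] is the usual real power. *)
Definition quadratic_power_sum (R : realType) (n : nat) (a b c : 'I_n -> R)
    (alpha : R) (x : R) : R :=
  \sum_(k < n) c k * ((x - a k) ^+ 2 + b k ^+ 2) `^ alpha.

Definition critical_points (R : realType) (f : R -> R) : set R :=
  [set x | derivable f x 1 /\ f^`() x = 0].

(* Main.v *)
(* Put [lam = - alpha] and regard [((x - a)^2 + b^2)^(- lam)] as the restriction to the
   axis [y = 0] of the fundamental solution, with pole [(a, b)] in the upper half
   plane, of the axially symmetric operator [d_xx + d_yy + (2 lam / y) d_y].  A linear
   combination [V] of [m] such solutions with distinct poles tends to [0] at infinity
   and obeys the maximum principle away from the poles, so every component of [V > 0]
   or [V < 0] contains a pole.  By planarity the components met successively along the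
   axis form a Davenport-Schinzel sequence of order 2 on at most [m] letters: the
   restriction to the axis has at most [2 m - 1] alternating signs.

   A suitable difference quotient of [f], plus a small multiple of one power, is a
   combination of [2 n] powers, and [4 n - 1] zeros of [f'] would make it alternate
   [4 n] times; here [f'] vanishes on no interval because [f] is real analytic and
   tends to [0] at infinity.

   To stay elementary, the fundamental solution is truncated to a finite sum, whose
   image under the operator is a single small term away from the pole, and the maximum
   principle and planarity are used on a fine triangulated grid. *)

(* The full series is singular at its pole, so no mesh resolves it there. A truncated series has
   locally bounded derivatives, hence a scheme error [O(h)], but with a constant that depends on the
   order [J] of truncation. This dictates the order of choices: the region, then the size of the
   boxes around the poles, then [J], and the mesh last. It also requires the decay at infinity and
   the bounds away from the poles to be uniform in [J].

   The truncated series is not annihilated by the operator. Away from the poles the defect and the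
   scheme error are both small, and they are absorbed by a linear tilt of slope [e], which the drift
   term of the operator makes visible and which changes the values by a fraction of the threshold
   [eta] only.

   The multiple of one power is added because [f'] may touch zero without changing sign. Adding a
   small multiple of a positive function, of either sign, turns the zeros of [f'] into points of a
   prescribed sign; on average over the two choices, each zero contributes one alternation. *)
Require Import Defs.
From mathcomp Require Import all_boot all_order all_algebra.
From mathcomp Require Import all_classical all_reals all_analysis.
From mathcomp Require Import zify ring lra.

Set Implicit Arguments.
Unset Strict Implicit.
Unset Printing Implicit Defensive.

Import Order.TTheory GRing.Theory Num.Theory.
Import numFieldNormedType.Exports.

(** * Combinatorics of sign patterns on a triangulated grid *)

(** If the first letter [a] recurs, cut before its next occurrence. A letter on both sides of the
    cut would complete a pattern [a x a x], so the two sides have disjoint alphabets, of sizes [p]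
    and [q]; their bounds [2 p - 1] and [2 q - 1], with the initial [a], add up to
    [2 (p + q) - 1]. *)
Lemma davenport_schinzel2 (T : eqType) (s : seq T) :
  (forall a b, a != b -> ~~ subseq [:: a; b; a; b] s) ->
  sorted (fun x y => x != y) s -> s != [::] ->
  (size s < 2 * size (undup s))%N.
Proof.
have [k] := ubnP (size s); elim: k s => // k IH [|a s] // sk noabab srt _.
have sub_s s' : subseq s' (a :: s) ->
    forall x y, x != y -> ~~ subseq [:: x; y; x; y] s'.
  by move=> s's x y /noabab; apply: contra => /subseq_trans; apply.
have [as_|as_] := boolP (a \in s); last first.
  rewrite /= (negPf as_) /=; case: s => [|b s] // in sk noabab srt sub_s as_ *.
  have := IH (b :: s) _ (sub_s _ (subseq_cons _ _)) (path_sorted srt) isT.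
  by rewrite /= in sk * => /(_ ltac:(lia)); lia.
pose u := take (index a s) s; pose v := drop (index a s).+1 s.
have Es : s = u ++ a :: v.
  rewrite -[LHS](cat_take_drop (index a s)) (drop_nth a) ?index_mem //.
  by rewrite nth_index.
have au : a \notin u by rewrite in_take_leq ?ltnn // index_size.
move: u v au Es => u v au Es; subst s; clear as_.
have u0 : u != [::] by case: u srt {sk noabab sub_s au} => //=; rewrite eqxx.
have usub : subseq u (a :: u ++ a :: v).
  exact: subseq_trans (prefix_subseq _ _) (subseq_cons _ _).
have vsub : subseq (a :: v) (a :: u ++ a :: v).
  exact: subseq_trans (suffix_subseq _ _) (subseq_cons _ _).
have [srtu srtv] : sorted (fun x y => x != y) u /\ sorted (fun x y => x != y) (a :: v).
  by have /cat_sorted2[] := path_sorted srt.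
rewrite /= size_cat /= in sk.
have uB := IH u ltac:(lia) (sub_s _ usub) srtu u0.
have vB := IH (a :: v) ltac:(rewrite /=; lia) (sub_s _ vsub) srtv isT.
have uvB : (size (undup u ++ undup (a :: v)) <= size (undup (a :: u ++ a :: v)))%N.
  apply: uniq_leq_size; last first.
    move=> x; rewrite mem_cat !mem_undup [in X in _ -> X]inE mem_cat.
    by case/orP=> ->; rewrite ?orbT.
  rewrite cat_uniq !undup_uniq andbT; apply/hasPn => x.
  suff: x \in undup (a :: v) -> x \notin undup u by [].
  rewrite !mem_undup inE => /predU1P[->//|xv].
  apply/negP => xu.
  have ax : a != x by apply: contraNneq au => ->.
  have /negP[] := noabab a x ax.
  rewrite /= eqxx -/([:: a; x] ++ _) -[[:: x; a; x]]/([:: x] ++ [:: a; x]).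
  by rewrite cat_subseq ?sub1seq //= eqxx sub1seq.
rewrite size_cat in uvB; rewrite /= size_cat /= in vB uvB *.
lia.
Qed.

(** Each cell has a single diagonal, always in the direction [(1, 1)], so the graph is planar: edges
    meet at common vertices only, and paths that cross share a vertex. *)
Definition grid_step (p q : nat * nat) :=
  ((q.1 == p.1.+1) && ((q.2 == p.2) || (q.2 == p.2.+1))) ||
  ((q.1 == p.1) && (q.2 == p.2.+1)).

Definition grid_adj p q := grid_step p q || grid_step q p.

(* Whether the edge pq meets the vertical ray going up from just right of v. *)
Definition ray_crosses (v p q : nat * nat) :=
  ((p.1 <= v.1) (+) (q.1 <= v.1)) && (v.2 < if p.1 < q.1 then p.2 else q.2).

Fixpoint ray_parity (v p : nat * nat) (s : seq (nat * nat)) :=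
  if s is q :: s' then ray_crosses v p q (+) ray_parity v q s' else false.

(** When [v] moves to the next column, an edge that meets exactly one of the two rays has exactly
    one end in the new column above [v']. The change is thus a coboundary, which telescopes along a
    path; it vanishes at ends that lie on the bottom row. *)
Lemma ray_crosses_step v v' p q : grid_step v v' -> grid_adj p q ->
  v != p -> v != q -> v' != p -> v' != q ->
  ray_crosses v p q (+) ray_crosses v' p q =
    ((v.1 < v'.1) && (p.1 == v'.1) && (v'.2 < p.2)) (+)
    ((v.1 < v'.1) && (q.1 == v'.1) && (v'.2 < q.2)).
Proof.
case: v v' p q => [x y] [x' y'] [a b] [c d].
rewrite /grid_adj /grid_step /ray_crosses !xpair_eqE /=.
have Hd (P Q R : bool) : P && Q || R -> (P /\ Q) \/ R by case: P; case: Q; case: R; tauto.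
case/Hd=> [[/eqP-> /orP[]/eqP->]|/andP[/eqP-> /eqP->]];
case/orP => /Hd[[/eqP-> /orP[]/eqP->]|/andP[/eqP-> /eqP->]];
  rewrite ?ltnn ?ltnSn ?eqxx ?(gtn_eqF (ltnSn _)) ?(ltn_eqF (ltnSn _))
           ?[_.+1 < _]ltnNge ?leqnSn ?leqnn /=.
 all: lia.
Qed.

Lemma ray_parity_step v v' p s : grid_step v v' -> path grid_adj p s ->
  v \notin p :: s -> v' \notin p :: s -> p.2 = 0%N -> (last p s).2 = 0%N ->
  ray_parity v p s = ray_parity v' p s.
Proof.
move=> vv' ps vps v'ps p0 l0.
pose h (q : nat * nat) := (v.1 < v'.1) && (q.1 == v'.1) && (v'.2 < q.2).
have h0 q : q.2 = 0%N -> h q = false by rewrite /h => ->; rewrite andbF.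
suff : ray_parity v p s (+) ray_parity v' p s = h p (+) h (last p s).
  by rewrite !h0 //; case: ray_parity; case: ray_parity.
elim: s p {p0 l0} ps vps v'ps => [|q s IH] p /=; first by rewrite addbb.
move=> /andP[pq qs]; rewrite !inE !negb_or => /and3P[vp vq vs] /and3P[v'p v'q v's].
have := IH q qs; rewrite !inE !negb_or vq vs v'q v's => /(_ isT isT) {}IH.
have := ray_crosses_step vv' pq vp vq v'p v'q.
rewrite -/(h p) -/(h q) => E.
rewrite addbACA E IH. by case: (h p); case: (h q); case: (h _).
Qed.

(** From the bottom row every passage between columns [x] and [x + 1] counts: it could be missed
    only if its left end were [(x, 0)] itself. *)
Lemma ray_parity_bottom x p s : path grid_adj p s -> (x, 0%N) \notin p :: s ->
  ray_parity (x, 0%N) p s = (p.1 <= x) (+) ((last p s).1 <= x).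
Proof.
elim: s p => [|q s IH] p /=; first by rewrite addbb.
move=> /andP[pq qs]; rewrite !inE !negb_or => /and3P[vp vq vs].
rewrite IH // ?inE ?negb_or ?vq //.
have -> : ray_crosses (x, 0%N) p q = (p.1 <= x) (+) (q.1 <= x).
  case: p q pq vp vq {qs} => a b [c d]; rewrite /grid_adj /grid_step /ray_crosses !xpair_eqE /=.
  by case: (ltnP a c) => ?; case: (leqP a x) => ?; case: (leqP c x) => ?; lia.
by case: (_ <= _); case: (_ <= _); case: (_ <= _).
Qed.

(** A discrete Jordan argument: if the paths were disjoint, the crossing parity of [s] would be
    constant along [t]; but it is odd at [(j, 0)], between the ends of [s], and even at [(l, 0)],
    beyond both. *)
Lemma grid_paths_cross i j k l s t : (i <= j)%N -> (j < k)%N -> (k <= l)%N ->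
  path grid_adj (i, 0%N) s -> last (i, 0%N) s = (k, 0%N) ->
  path grid_adj (j, 0%N) t -> last (j, 0%N) t = (l, 0%N) ->
  exists2 v, v \in (i, 0%N) :: s & v \in (j, 0%N) :: t.
Proof.
move=> ij jk kl ps ls pt lt.
have [/hasP[v vt vs]|] := boolP (has (mem ((i, 0%N) :: s)) ((j, 0%N) :: t)).
  by exists v.
move/hasPn => dis.
have cst u : path grid_adj u t -> (forall v, v \in u :: t -> v \notin (i, 0%N) :: s) ->
    ray_parity u (i, 0%N) s = ray_parity (last u t) (i, 0%N) s.
  elim: t u {pt lt dis} => //= q t IH u /andP[uq qt] dis.
  rewrite -(IH q qt); last by move=> v vt; apply: dis; rewrite inE vt orbT.
  have du : u \notin (i, 0%N) :: s by apply: dis; rewrite inE eqxx.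
  have dq : q \notin (i, 0%N) :: s by apply: dis; rewrite !inE eqxx orbT.
  case/orP: uq => uq; first by apply: ray_parity_step => //; rewrite ls.
  by symmetry; apply: ray_parity_step => //; rewrite ls.
have dj : (j, 0%N) \notin (i, 0%N) :: s by apply: dis; rewrite inE eqxx.
have dl : (l, 0%N) \notin (i, 0%N) :: s by apply: dis; rewrite -lt mem_last.
have := cst _ pt dis; rewrite lt !ray_parity_bottom // ls /=.
by lia.
Qed.

(** * Discrete maximum principle and sign components on the grid *)

Local Open Scope ring_scope.

(* At [j = 0] the truncated [j.-1] is harmless, as [B 0 = 0] in every use. *)
Definition grid_op (R : realFieldType) (A D : R) (B : nat -> R)
    (V : nat -> nat -> R) (i j : nat) : R :=
  A * (V i.+1 j + V i.-1 j - 2 * V i j)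
  + B j * (V i j.+1 + V i j.-1 - 2 * V i j) + D * (V i j.+1 - V i j).

Lemma grid_opZ (R : realFieldType) (A D c : R) B V i j :
  grid_op A D B (fun k l => c * V k l) i j = c * grid_op A D B V i j.
Proof. by rewrite /grid_op; ring. Qed.

(* At a maximum point of [V + e j] over [C] every neighbour has a smaller value,
   inside [C] by maximality and outside because [V <= 0] there. *)
Lemma grid_max_principle (R : realFieldType) (n : nat) (A D e eta : R)
    (B : nat -> R) (V : nat -> nat -> R) (C : pred (nat * nat)) (u0 : nat * nat) :
  0 <= A -> (forall j, 0 <= B j) -> B 0%N = 0 -> 0 < D -> 0 < e ->
  e * n%:R < eta ->
  (u0.1 <= n)%N -> (u0.2 <= n)%N -> C u0 -> eta <= V u0.1 u0.2 ->
  (forall u v, C u -> grid_adj u v -> (v.1 <= n)%N -> (v.2 <= n)%N ->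
     ~~ C v -> V v.1 v.2 <= 0) ->
  (forall u, C u -> (u.1 == 0%N) || (u.1 == n) || (u.2 == n) ->
     V u.1 u.2 + e * n%:R < eta) ->
  exists u, [/\ C u, (0 < u.1 < n)%N, (u.2 < n)%N
    & grid_op A D B V u.1 u.2 <= - (D * e)].
Proof.
move=> A0 B0 B00 D0 e0 en u01 u02 Cu0 Vu0 out bnd.
pose G := ('I_n.+1 * 'I_n.+1)%type.
pose W (g : G) := V g.1 g.2 + e * (g.2 : nat)%:R.
pose v0 : G := (inord u0.1, inord u0.2).
pose CG (g : G) := C (g.1 : nat, g.2 : nat).
have Cv0 : CG v0 by rewrite /CG !inordK //; case: (u0) Cu0.
pose g := [arg max_(g > v0 | CG g) W g]%O.
have [Cg gmax] : CG g /\ forall g', CG g' -> W g' <= W g.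
  by rewrite /g; case: Order.TotalTheory.arg_maxP.
have le_n (x : 'I_n.+1) : (x <= n)%N by rewrite -ltnS.
have en_le (y : nat) : (y <= n)%N -> e * y%:R <= e * n%:R.
  by move=> yn; rewrite ler_pM2l // ler_nat.
have Wg : eta <= W g.
  apply: le_trans (gmax _ Cv0); rewrite /W !inordK //.
  by apply: le_trans Vu0 _; rewrite lerDl mulr_ge0 // ltW.
have [gi gj] : (0 < g.1 < n)%N /\ (g.2 < n)%N.
  have nb : ~~ ((g.1 == 0%N :> nat) || (g.1 == n :> nat) || (g.2 == n :> nat)).
    apply/negP => /(bnd (_, _) Cg) /=.
    have := en_le _ (le_n g.2); move: Wg; rewrite /W; lra.
  by have := le_n g.1; have := le_n g.2; lia.
have nbr (v : nat * nat) : grid_adj (g.1 : nat, g.2 : nat) v -> (v.1 <= n)%N -> (v.2 <= n)%N ->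
    V v.1 v.2 + e * v.2%:R <= W g.
  move=> av v1 v2; have [Cv|Cv] := boolP (C v).
    have := gmax (inord v.1, inord v.2).
    by rewrite /CG /W !inordK //; apply; case: (v) Cv.
  have := out (_, _) v Cg av v1 v2 Cv; have := en_le _ v2; move: Wg; lra.
exists (g.1 : nat, g.2 : nat); split => //=.
move: gi gj nbr; rewrite /W /grid_op /grid_adj /grid_step.
move: (g.1 : nat) (g.2 : nat) => i j /=.
clear en Wg gmax Cg Cv0 out bnd W CG g en_le v0 G le_n u01 u02 Cu0 Vu0 => gi gj nbr.
have {}nbr x y : (x = i.+1 \/ i = x.+1) /\ y = j \/ x = i /\ (y = j.+1 \/ j = y.+1) ->
    V x y + e * y%:R <= V i j + e * j%:R.
  by move=> xy; apply: (nbr (x, y)) => /=; lia.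
have h1 := nbr i.+1 j ltac:(lia).
have h2 := nbr i.-1 j ltac:(lia).
have h3 := nbr i j.+1 ltac:(lia).
rewrite -natr1 in h3; set v := V i j in nbr h1 h2 h3 *.
have a1 : A * (V i.+1 j + V i.-1 j - 2 * v) <= 0.
  by apply: mulr_ge0_le0 => //; lra.
(* Second differences do not see the linear tilt; the forward difference does, and this gives the
   strict bound. *)
have a3 : D * (V i j.+1 - v) <= - (D * e).
  by rewrite -mulrN ler_pM2l //; lra.
suff a2 : B j * (V i j.+1 + V i j.-1 - 2 * v) <= 0 by lra.
have [z|z] := posnP j; first by rewrite z B00 mul0r.
have h4 := nbr i j.-1 ltac:(lia).
have E : j%:R = (j.-1)%:R + 1 :> R by rewrite natr1 prednK.
by rewrite E in h3 h4; apply: mulr_ge0_le0 => //; lra.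
Qed.

Definition convex_pred (P : pred nat) :=
  forall i j k, P i -> P k -> (i <= j <= k)%N -> P j.

Section GridAlternation.
Variables (R : realFieldType) (n m : nat) (A D e eta : R) (B : nat -> R).
Variables (V : nat -> nat -> R) (px py : 'I_m -> pred nat).
Hypotheses (A0 : 0 <= A) (B0 : forall j, 0 <= B j) (B00 : B 0%N = 0).
Hypotheses (D0 : 0 < D) (e0 : 0 < e) (en : e * n%:R < eta).
Hypothesis (pxP : forall k, convex_pred (px k)).
Hypothesis (pyP : forall k, convex_pred (py k)).
Definition grid_box k (u : nat * nat) := [&& px k u.1, py k u.2, (u.1 <= n)%N & (u.2 <= n)%N].
Notation box := grid_box.
Hypothesis sgV : forall k, (forall u, box k u -> 0 < V u.1 u.2) \/
                           (forall u, box k u -> V u.1 u.2 < 0).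
Hypothesis opV : forall i j, (0 < i < n)%N -> (j < n)%N ->
  (forall k, ~~ box k (i, j)) -> `|grid_op A D B V i j| < D * e.
Hypothesis bndV : forall i j, (i <= n)%N -> (j <= n)%N ->
  (i == 0%N) || (i == n) || (j == n) -> `|V i j| + e * n%:R < eta.

Let G := ('I_n.+1 * 'I_n.+1)%type.
Let pt (g : G) : nat * nat := (g.1 : nat, g.2 : nat).
Let v (g : G) := V g.1 g.2.
(** Its connected components are the discrete nodal domains of [V]. *)
Let same : rel G := fun g g' => grid_adj (pt g) (pt g') && (0 < v g * v g').

Lemma same_sym : connect_sym same.
Proof.
apply: sym_connect_sym => g g'.
by rewrite /same mulrC /grid_adj orbC.
Qed.

Lemma connect_same_sign g g' : v g != 0 -> connect same g g' -> 0 < v g * v g'.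
Proof.
move=> vg /connectP[s + ->].
elim/last_ind: s => [_|s x IH] /=; first by rewrite -expr2 exprn_even_gt0.
rewrite rcons_path last_rcons => /andP[/IH {}IH /andP[_ lx]].
set y := last g s in IH lx.
have : 0 < v g * v x * (v y) ^+ 2 by rewrite expr2; nra.
by rewrite pmulr_lgt0 // exprn_even_gt0 //=; apply: contraTneq lx => ->; rewrite mul0r ltxx.
Qed.

Lemma box_connected k g g' : box k (pt g) -> box k (pt g') -> connect same g g'.
Proof.
pose bx g := box k (pt g).
have in_n (x : 'I_n.+1) : (x <= n)%N by rewrite -ltnS.
have sg a b : bx a -> bx b -> 0 < v a * v b.
  move=> ba bb; case: (sgV k) => h; have := h _ ba; have := h _ bb; rewrite /v /=; nra.
have row d : forall a b, bx a -> bx b -> a.2 = b.2 -> b.1 = (a.1 + d)%N :> nat -> connect same a b.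
  elim: d => [|d IH] a b ba bb ab2 ab1.
    suff -> : a = b by exact: connect0.
    by case: a b ab1 ab2 {ba bb} => [a1 a2] [b1 b2] /=; rewrite addn0 => /esym/val_inj-> ->.
  have cn : (a.1.+1 < n.+1)%N by have := ltn_ord b.1; lia.
  pose c : G := (Ordinal cn, a.2).
  have bc : bx c.
    move: ba bb => /and4P[pa qa _ _] /and4P[pb _ _ _]; apply/and4P; split; rewrite /= ?in_n //.
    by apply: (pxP pa pb) => /=; lia.
  apply: connect_trans (IH c b bc bb _ _) => //; last by rewrite /= ab1 addnS.
  by apply: connect1; rewrite /same sg // /grid_adj /grid_step /= !eqxx.
have col d : forall a b, bx a -> bx b -> a.1 = b.1 -> b.2 = (a.2 + d)%N :> nat -> connect same a b.
  elim: d => [|d IH] a b ba bb ab1 ab2.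
    suff -> : a = b by exact: connect0.
    by case: a b ab1 ab2 {ba bb} => [a1 a2] [b1 b2] /= ->; rewrite addn0 => /esym/val_inj->.
  have cn : (a.2.+1 < n.+1)%N by have := ltn_ord b.2; lia.
  pose c : G := (a.1, Ordinal cn).
  have bc : bx c.
    move: ba bb => /and4P[pa qa _ _] /and4P[_ qb _ _]; apply/and4P; split; rewrite /= ?in_n //.
    by apply: (pyP qa qb) => /=; lia.
  apply: connect_trans (IH c b bc bb _ _) => //; last by rewrite /= ab2 addnS.
  by apply: connect1; rewrite /same sg // /grid_adj /grid_step /= !eqxx /= ?orbT.
have row' a b : bx a -> bx b -> a.2 = b.2 -> connect same a b.
  move=> ba bb ab; case: (leqP a.1 b.1) => [le|/ltnW le].
    by apply: (row (b.1 - a.1)%N) => //; rewrite subnKC.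
  by rewrite same_sym; apply: (row (a.1 - b.1)%N) => //; rewrite subnKC.
have col' a b : bx a -> bx b -> a.1 = b.1 -> connect same a b.
  move=> ba bb ab; case: (leqP a.2 b.2) => [le|/ltnW le].
    by apply: (col (b.2 - a.2)%N) => //; rewrite subnKC.
  by rewrite same_sym; apply: (col (a.2 - b.2)%N) => //; rewrite subnKC.
move=> bg bg'; pose c : G := (g.1, g'.2).
have bc : bx c by move: bg bg' => /and4P[? ? ? ?] /and4P[? ? ? ?]; apply/and4P.
by apply: connect_trans (col' g c _ _ _) (row' c g' _ _ _).
Qed.

(** Otherwise the maximum principle, applied on the component of [g] to [V] or [- V], gives a vertex
    outside all boxes where the operator is at least [D * e] in absolute value, against [opV]. *)
Lemma component_meets_box g : eta <= `|v g| ->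
  [exists k, [exists g', box k (pt g') && connect same g g']].
Proof.
move=> vg; apply: contraT => nobox.
have vg0 : v g != 0.
  by rewrite -normr_gt0; apply: lt_le_trans vg; apply: le_lt_trans en; rewrite mulr_ge0 // ltW.
pose c := Num.sg (v g).
have c1 : `|c| = 1 by rewrite normr_sg vg0.
have cc : c * c = 1 by rewrite -expr2 sqr_sg vg0.
pose C (u : nat * nat) := [&& (u.1 <= n)%N, (u.2 <= n)%N
                            & connect same g (inord u.1, inord u.2)].
have Cpos u : C u -> 0 < c * V u.1 u.2.
  case/and3P => u1 u2 /(connect_same_sign vg0).
  have -> : v (inord u.1, inord u.2) = V u.1 u.2 by rewrite /v /= !inordK.
  by rewrite [v g]numEsg -/c mulrAC (pmulr_lgt0 (c * _)) ?normr_gt0.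
have in1 (x : 'I_n.+1) : (x <= n)%N by rewrite -ltnS.
have Cg : C (pt g) by rewrite /C /= !in1 !inord_val -surjective_pairing connect0.
have := @grid_max_principle R n A D e eta B (fun i j => c * V i j) C (pt g) A0 B0 B00 D0 e0 en.
rewrite /= !in1 Cg -/(v g) /c -normrEsg => /(_ isT isT isT vg) [||u [Cu u1 u2]].
- move=> u w Cu uw w1 w2; rewrite leNgt; apply: contra => cw.
  case/and3P: (Cu) => u1 u2 gu; rewrite /C w1 w2 /=; apply: connect_trans gu _.
  apply: connect1; rewrite /same /pt /v /= !inordK //.
  rewrite -[X in grid_adj X _]/(u.1, u.2).
  have -> : grid_adj (u.1, u.2) (w.1, w.2) by case: (u) (w) uw => [? ?] [? ?].
  by have := Cpos _ Cu; rewrite -/c in cw *; nra.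
- move=> u Cu ub; case/and3P: (Cu) => u1 u2 gu.
  have := bndV u1 u2 ub; have := ler_norm (c * V u.1 u.2); rewrite normrM c1 mul1r -/c.
  lra.
rewrite grid_opZ -/c => opu.
case/and3P: Cu => u1' u2' gu.
have : `|grid_op A D B V u.1 u.2| < D * e.
  apply: opV => // k; apply: contraNN nobox => bk; apply/existsP; exists k; apply/existsP.
  by exists (inord u.1, inord u.2); rewrite gu andbT /pt /= !inordK.
have := ler_norm (- (c * grid_op A D B V u.1 u.2)).
rewrite normrN normrM c1 mul1r; lra.
Qed.

(** The letter of a component. The choice depends only on the boxes that the component meets, so
    equal components have equal letters; conversely a box is connected, so equal letters mean equal
    components. *)
Let pick_box (i : nat) : option 'I_m :=
  [pick k | [exists g', box k (pt g') && connect same (inord i, ord0) g']].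

(** The letters met along the axis form a word over at most [m] letters. Neighbouring letters differ
    because the signs do, and a pattern [a b a b] would give two crossing paths, hence a single
    component for [a] and [b]. *)
Lemma grid_alternation (L : seq nat) : L != [::] ->
  sorted ltn L -> (forall i, i \in L -> (i <= n)%N /\ eta <= `|V i 0|) ->
  sorted (fun i j => (0 < V i 0) != (0 < V j 0)) L -> (size L < 2 * m)%N.
Proof.
move=> L0 Lsrt LP Lalt.
pose p i : G := (inord i, ord0).
have vp i : i \in L -> v (p i) = V i 0 by case/LP => iL _; rewrite /v /= inordK.
have vp0 i : i \in L -> v (p i) != 0.
  move=> iL; rewrite vp // -normr_gt0; case: (LP i iL) => _; apply: lt_le_trans.
  by apply: le_lt_trans en; rewrite mulr_ge0 // ltW.
have pickP i : i \in L -> exists2 k, pick_box i = Some k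
    & exists2 g, box k (pt g) & connect same (p i) g.
  move=> iL; have [i_n etai] := LP i iL.
  rewrite /pick_box; case: pickP => [k /existsP[g /andP[bg cg]]|no].
    by exists k => //; exists g.
  have /existsP[k] := component_meets_box (g := p i) ltac:(by rewrite vp).
  by rewrite no.
have conn i j : i \in L -> j \in L -> pick_box i = pick_box j -> connect same (p i) (p j).
  move=> iL jL; have [k -> [g bg cg]] := pickP i iL; have [k' -> [g' bg' cg']] := pickP j jL.
  move=> [kk']; subst k'; apply: connect_trans cg _; apply: connect_trans (box_connected bg bg') _.
  by rewrite same_sym.
have pick_eq i j : connect same (p i) (p j) -> pick_box i = pick_box j.
  move=> ij; apply: eq_pick => k; apply: eq_existsb => g.
  by rewrite (same_connect same_sym ij).
have cpath i j : i \in L -> j \in L -> pick_box i = pick_box j ->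
    exists s, [/\ path grid_adj (i, 0%N) s, last (i, 0%N) s = (j, 0%N)
      & forall u, u \in (i, 0%N) :: s -> exists2 g, pt g = u & connect same (p i) g].
  move=> iL jL /(conn _ _ iL jL) /connectP[s sP sj].
  have ptp k : k \in L -> pt (p k) = (k, 0%N) by case/LP => kn _; rewrite /pt /= inordK.
  exists (map pt s); split; rewrite -?ptp //.
  - by rewrite path_map; apply: sub_path sP => g g' /andP[].
  - by rewrite last_map -sj.
  - move=> u; rewrite -map_cons => /mapP[g gs ->]; exists g => //.
    by move: gs; rewrite inE => /predU1P[->//|gs]; apply: (path_connect sP); rewrite inE gs orbT.
have DS : (size (map pick_box L) < 2 * size (undup (map pick_box L)))%N.
  apply: davenport_schinzel2.
  - move=> a b ab; apply/negP => /subseqP[msk szm Es].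
    have := subseq_sorted ltn_trans (mask_subseq msk L) Lsrt.
    have : {subset mask msk L <= L} by move=> x; apply: mem_mask.
    rewrite -map_mask in Es; case: (mask msk L) Es => [|i [|j [|k [|l [|? ?]]]]] //=.
    move=> [ai bj ak bl] sub /and4P[ij jk kl _].
    have iL : i \in L by apply: sub; rewrite !inE eqxx ?orbT.
    have jL : j \in L by apply: sub; rewrite !inE eqxx ?orbT.
    have kL : k \in L by apply: sub; rewrite !inE eqxx ?orbT.
    have lL : l \in L by apply: sub; rewrite !inE eqxx ?orbT.
    have [s [s1 s2 s3]] := cpath i k iL kL ltac:(by rewrite -ai -ak).
    have [t [t1 t2 t3]] := cpath j l jL lL ltac:(by rewrite -bj -bl).
    have [u us ut] := grid_paths_cross (ltnW ij) jk (ltnW kl) s1 s2 t1 t2.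
    have [g ug cg] := s3 u us; have [g' ug' cg'] := t3 u ut.
    have gg' : g = g'.
      move: ug ug'; case: g {cg} => g1 g2; case: g' {cg'} => g1' g2'.
      by rewrite /pt /= => <- [] /esym/val_inj -> /esym/val_inj ->.
    move/eqP: ab; apply; rewrite ai bj; apply: pick_eq; apply: connect_trans cg _.
    by rewrite gg' same_sym.
  - rewrite sorted_map; move: Lalt; apply: (sub_in_sorted (P := mem L)); last exact/allP.
    move=> i j iL jL /=; apply: contra => /eqP/(conn _ _ iL jL)/(connect_same_sign (vp0 i iL)).
    rewrite !vp // => ij; apply/eqP; apply/idP/idP => h; nra.
  - by case: (L) L0.
rewrite size_map in DS; apply: leq_trans DS _; rewrite leq_mul2l /=.
rewrite -[X in (_ <= X)%N](card_ord m) cardE -[X in (_ <= X)%N](size_map Some).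
apply: uniq_leq_size.
  exact: undup_uniq.
move=> x; rewrite mem_undup => /mapP[i iL ->]; have [k -> _] := pickP i iL.
by apply/mapP; exists k => //; rewrite mem_enum.
Qed.
End GridAlternation.

Local Open Scope classical_set_scope.

(** * Finite differences and monomials *)

Lemma is_derive_continuous (R : realType) (f : R -> R) (x df : R) :
  is_derive x 1 f df -> {for x, continuous f}.
Proof. by move=> /@ex_derive /derivable1_diffP /differentiable_continuous. Qed.

Lemma MVT_closed (R : realType) (f df : R -> R) (a b : R) : a <= b ->
  (forall x, a <= x <= b -> is_derive x 1 f (df x)) ->
  exists2 c, a <= c <= b & f b - f a = df c * (b - a).
Proof.
move=> ab fdf; have [x xab|x|c] := MVT_segment ab (df := df) (f := f).
- by apply: fdf; rewrite !ltW ?(itvP xab).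
- apply: continuous_in_subspaceT => y; rewrite inE /= in_itv /= => yab.
  exact: is_derive_continuous (fdf y yab).
- by rewrite in_itv /= => cab E; exists c.
Qed.

Lemma is_derive_shift (R : realType) (f : R -> R) (x h df : R) :
  is_derive (x + h) 1 f df -> is_derive x 1 (fun y => f (y + h)) df.
Proof.
move=> fdf; have := @is_derive1_comp R f (fun y => y + h) x df 1 fdf.
by rewrite mulr1; apply; apply: is_derive_eq; rewrite addr0.
Qed.

Lemma second_difference (R : realType) (g g1 g2 g3 : R -> R) (x h C : R) :
  0 <= h ->
  (forall y, x - h <= y <= x + h -> is_derive y 1 g (g1 y)) ->
  (forall y, x - h <= y <= x + h -> is_derive y 1 g1 (g2 y)) ->
  (forall y, x - h <= y <= x + h -> is_derive y 1 g2 (g3 y)) ->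
  (forall y, x - h <= y <= x + h -> `|g3 y| <= C) ->
  `|g (x + h) + g (x - h) - 2 * g x - h ^+ 2 * g2 x| <= C * h ^+ 3.
Proof.
move=> h0 d1 d2 d3 g3C.
have C0 : 0 <= C by apply: le_trans (g3C x _); rewrite ?normr_ge0 //; lra.
(* The second difference is the increment over [[x - h, x]] of [y |-> g (y + h) - g y]. Two uses of
   the mean value theorem turn it into [h ^ 2] times [g2 d] with [d] within [h] of [x]. *)
have [|y yxh|c cx E] := @MVT_closed R (fun y => g (y + h) - g y)
    (fun y => g1 (y + h) - g1 y) (x - h) x; first by lra.
  apply: is_deriveB; last by apply: d1; lra.
  by apply: is_derive_shift; apply: d1; lra.
have [|y yxh|d dx E2] := @MVT_closed R g1 g2 c (c + h); first by lra.
  by apply: d2; lra.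
have -> : g (x + h) + g (x - h) - 2 * g x - h ^+ 2 * g2 x = h ^+ 2 * (g2 d - g2 x).
  move: E; rewrite E2 subrK => E; have {}E : g (x + h) - g x - (g x - g (x - h)) = g2 d * h * h.
    by rewrite E; ring.
  by transitivity (g (x + h) - g x - (g x - g (x - h)) - h ^+ 2 * g2 x); [|rewrite E]; ring.
have dC : `|g2 d - g2 x| <= C * h.
  have [xd|/ltW xd] := leP x d.
    have [y yxh|e ed ->] := @MVT_closed R g2 g3 x d xd; first by apply: d3; lra.
    rewrite normrM ler_pM //; first by apply: g3C; lra.
    by rewrite ger0_norm; lra.
  have [y yxh|e ed E3] := @MVT_closed R g2 g3 d x xd; first by apply: d3; lra.
  rewrite distrC E3 normrM ler_pM //; first by apply: g3C; lra.
  by rewrite ger0_norm; lra.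
rewrite normrM ger0_norm ?sqr_ge0 // [_ ^+ 3]exprS mulrA mulrC.
by rewrite ler_wpM2r ?sqr_ge0.
Qed.

Lemma first_difference (R : realType) (g g1 g2 : R -> R) (x h C : R) :
  0 <= h ->
  (forall y, x <= y <= x + h -> is_derive y 1 g (g1 y)) ->
  (forall y, x <= y <= x + h -> is_derive y 1 g1 (g2 y)) ->
  (forall y, x <= y <= x + h -> `|g2 y| <= C) ->
  `|g (x + h) - g x - h * g1 x| <= C * h ^+ 2.
Proof.
move=> h0 d1 d2 g2C.
have xh : x <= x + h by lra.
have [c cx E] := MVT_closed xh d1.
have xc : x <= c by lra.
have [y yxh|e ex E2] := @MVT_closed R g1 g2 x c xc.
  by apply: d2; lra.
have -> : g (x + h) - g x - h * g1 x = h * (g2 e * (c - x)) by rewrite E -E2; ring.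
rewrite !normrM [`|h|]ger0_norm // [`|c - x|]ger0_norm; last by lra.
rewrite expr2 [C * _]mulrCA ler_wpM2l // ler_pM ?normr_ge0 //; try lra.
by apply: g2C; lra.
Qed.

Lemma is_derive_exp (R : realType) (f : R -> R) (x df : R) (n : nat) :
  is_derive x 1 f df -> is_derive x 1 (fun y => f y ^+ n) (n%:R * f x ^+ n.-1 * df).
Proof.
move=> fdf; elim: n => [|n IH]; first by rewrite !mul0r; exact: is_derive_cst.
have := is_deriveM fdf IH; rewrite /GRing.scale /=.
have -> : f * (fun y => f y ^+ n) = (fun y => f y ^+ n.+1).
  by apply: funext => y; rewrite exprS.
move=> fn; apply: is_derive_eq; rewrite -natr1.
by case: n {IH fn} => [|n] /=; rewrite ?exprS; ring.
Qed.

Section Monomials.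
Variables (R : realType) (a b al : R).
Hypothesis b0 : 0 < b.

Definition quad (x w : R) := (x - a) ^+ 2 + w + b ^+ 2.

(** The linear span of this family is stable under both partial derivatives, so one local bound on
    monomials controls all the remainders of the scheme. *)
Definition monomial (i j p : nat) (x w : R) :=
  (x - a) ^+ i * w ^+ j * quad x w `^ (al - p%:R).

Lemma quad_ge x w : 0 <= w -> b ^+ 2 <= quad x w.
Proof. by move=> w0; rewrite lerDr addr_ge0 ?sqr_ge0. Qed.

Lemma quad_gt0 x w : 0 <= w -> 0 < quad x w.
Proof. by move=> /(quad_ge x); apply: lt_le_trans; rewrite exprn_gt0. Qed.

Lemma powR_monomial_shift x w p : 0 <= w ->
  quad x w `^ (al - p%:R) = quad x w `^ (al - p.+1%:R) * quad x w.
Proof.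
move=> w0; have q0 := quad_gt0 x w0.
rewrite -[X in _ * X]powRr1 ?ltW // -powRD; last by rewrite (gt_eqF q0) implybT.
by congr (_ `^ _); rewrite -natr1; ring.
Qed.

Lemma is_derive_monomial_x i j p (x w : R) : 0 <= w ->
  is_derive x 1 (monomial i j p ^~ w)
    (i%:R * monomial i.-1 j p x w + 2 * (al - p%:R) * monomial i.+1 j p.+1 x w).
Proof.
move=> w0; rewrite /monomial /quad.
have dq : is_derive x 1 (fun x => (x - a) ^+ 2 + w + b ^+ 2) (2 * (x - a)).
  by apply: is_derive_eq; rewrite !subr0 /GRing.scale /=; ring.
have dp := @is_derive1_comp R (fun y => y `^ (al - p%:R)) _ x _ _
  (is_derive1_powR _ (quad_gt0 x w0)) dq.
have di : is_derive x 1 (fun x => (x - a) ^+ i) (i%:R * (x - a) ^+ i.-1).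
  have dx : is_derive x 1 (fun x => x - a) 1 by apply: is_derive_eq; rewrite subr0.
  by have := is_derive_exp i dx; rewrite mulr1.
have dij : is_derive x 1 (fun x => (x - a) ^+ i * w ^+ j) (i%:R * (x - a) ^+ i.-1 * w ^+ j).
  by apply: is_derive_eq; rewrite /GRing.scale /=; ring.
apply: (is_derive_eq (is_deriveM dij dp)).
have -> : al - p.+1%:R = al - p%:R - 1 by rewrite -natr1; ring.
by rewrite /GRing.scale /= -/(quad x w) (exprS _ i); ring.
Qed.

Lemma is_derive_monomial_w i j p (x w : R) : 0 <= w ->
  is_derive w 1 (monomial i j p x)
    (j%:R * monomial i j.-1 p x w + (al - p%:R) * monomial i j p.+1 x w).
Proof.
move=> w0; rewrite /monomial /quad.
have dq : is_derive w 1 (fun w => (x - a) ^+ 2 + w + b ^+ 2) 1.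
  by apply: is_derive_eq; rewrite ?subr0 /GRing.scale /=; ring.
have dp := @is_derive1_comp R (fun y => y `^ (al - p%:R)) _ w _ _
  (is_derive1_powR _ (quad_gt0 x w0)) dq.
have dj : is_derive w 1 (fun w => w ^+ j) (j%:R * w ^+ j.-1).
  by have := is_derive_exp j (is_derive_id w 1); rewrite mulr1.
have dij : is_derive w 1 (fun w => (x - a) ^+ i * w ^+ j) ((x - a) ^+ i * (j%:R * w ^+ j.-1)).
  by apply: is_derive_eq; rewrite /GRing.scale /=; ring.
apply: (is_derive_eq (is_deriveM dij dp)).
have -> : al - p.+1%:R = al - p%:R - 1 by rewrite -natr1; ring.
by rewrite /GRing.scale /= -/(quad x w); ring.
Qed.

Definition locally_bounded (phi : R -> R -> R) := forall rho,
  exists C, forall x w, `|x| <= rho -> 0 <= w <= rho -> `|phi x w| <= C.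

(** On the region [quad] stays between [b ^ 2] and [M], so its logarithm is bounded; this handles
    exponents of either sign at once. *)
Lemma monomial_bounded i j p : locally_bounded (monomial i j p).
Proof.
move=> rho; pose M := (rho + `|a|) ^+ 2 + rho + b ^+ 2.
exists ((rho + `|a|) ^+ i * rho ^+ j *
        expR (`|al - p%:R| * (`|ln (b ^+ 2)| + `|ln M|))) => x w xr /andP[w0 wr].
have q0 := quad_gt0 x w0.
have xa : `|x - a| <= rho + `|a| by apply: le_trans (ler_normB _ _) _; rewrite lerD2r.
have r0 : 0 <= rho by exact: le_trans wr.
rewrite /monomial !normrM !normrX.
rewrite ler_pM ?mulr_ge0 ?exprn_ge0 ?normr_ge0 //.
  rewrite ler_pM ?exprn_ge0 ?normr_ge0 // lerXn2r ?nnegrE ?addr_ge0 ?normr_ge0 //.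
  by rewrite ger0_norm.
rewrite ger0_norm ?powR_ge0 // /powR gt_eqF // ler_expR.
apply: le_trans (ler_norm _) _; rewrite normrM ler_wpM2l ?normr_ge0 //.
have qM : quad x w <= M.
  rewrite /quad /M lerD2r lerD // -[_ ^+ 2]ger0_norm ?sqr_ge0 // normrX.
  by rewrite lerXn2r ?nnegrE ?addr_ge0 ?normr_ge0.
have l1 : ln (b ^+ 2) <= ln (quad x w) by rewrite ler_ln ?posrE ?exprn_gt0 ?quad_ge.
have l2 : ln (quad x w) <= ln M by rewrite ler_ln ?posrE //; apply: lt_le_trans qM.
rewrite ler_norml; have := ler_norm (ln M); have := ler_norm (- ln (b ^+ 2)); rewrite normrN.
by have := normr_ge0 (ln M); have := normr_ge0 (ln (b ^+ 2)); lra.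
Qed.
End Monomials.

(** * Consistency of the difference scheme *)

Section Bounded.
Variable R : realType.
Implicit Types phi psi : R -> R -> R.

Lemma locally_boundedD phi psi : locally_bounded phi -> locally_bounded psi ->
  locally_bounded (fun x w => phi x w + psi x w).
Proof.
move=> hphi hpsi rho; have [C hC] := hphi rho; have [C' hC'] := hpsi rho.
exists (C + C') => x w xr wr; apply: le_trans (ler_normD _ _) _.
by rewrite lerD ?hC ?hC'.
Qed.

Lemma locally_boundedZ c phi : locally_bounded phi ->
  locally_bounded (fun x w => c * phi x w).
Proof.
move=> hphi rho; have [C hC] := hphi rho.
by exists (`|c| * C) => x w xr wr; rewrite normrM ler_wpM2l ?hC.
Qed.

(* Finite differences for [d_xx + 4 w d_ww + (2 + 4 lam) d_w], which is
   [d_xx + d_yy + (2 lam / y) d_y] in the variable [w = y^2].  In this variable the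
   coefficients are bounded up to the axis and the forward difference in [w] keeps the
   scheme monotone. *)
Definition discrete_op (lam h : R) phi (x w : R) :=
  (phi (x + h) w + phi (x - h) w - 2 * phi x w) / h ^+ 2
  + 4 * w * ((phi x (w + h) + phi x (w - h) - 2 * phi x w) / h ^+ 2)
  + (2 + 4 * lam) * ((phi x (w + h) - phi x w) / h).

(** For [0 < w < h] the stencil would leave the half plane [w >= 0]; at [w = 0] it does too, but
    there the coefficient [4 w] cancels the offending term. The constant [C] may depend on [phi]. *)
Definition consistent lam phi psi := forall rho, exists C, forall h x w,
  0 < h <= 1 -> `|x| <= rho -> 0 <= w <= rho -> w = 0 \/ h <= w ->
  `|discrete_op lam h phi x w - psi x w| <= C * h.

Lemma consistentD lam phi1 psi1 phi2 psi2 :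
  consistent lam phi1 psi1 -> consistent lam phi2 psi2 ->
  consistent lam (fun x w => phi1 x w + phi2 x w) (fun x w => psi1 x w + psi2 x w).
Proof.
move=> c1 c2 rho; have [C1 h1] := c1 rho; have [C2 h2] := c2 rho.
exists (C1 + C2) => h x w hh xr wr wh.
have := h1 h x w hh xr wr wh; have := h2 h x w hh xr wr wh.
set l := _ - psi2 x w; set l' := _ - psi1 x w => ? ?.
have -> : discrete_op lam h (fun x w => phi1 x w + phi2 x w) x w - (psi1 x w + psi2 x w) = l' + l.
  by rewrite /l /l' /discrete_op; ring.
by apply: le_trans (ler_normD _ _) _; rewrite mulrDl lerD.
Qed.

Lemma consistentZ lam c phi psi : consistent lam phi psi ->
  consistent lam (fun x w => c * phi x w) (fun x w => c * psi x w).
Proof.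
move=> c1 rho; have [C1 h1] := c1 rho.
exists (`|c| * C1) => h x w hh xr wr wh.
have -> : discrete_op lam h (fun x w => c * phi x w) x w - c * psi x w =
    c * (discrete_op lam h phi x w - psi x w).
  by rewrite /discrete_op; ring.
by rewrite normrM -mulrA ler_wpM2l // h1.
Qed.

Lemma consistent_derive lam phi fx fxx fxxx fw fww fwww :
  (forall x w : R, 0 <= w -> is_derive x 1 (phi ^~ w) (fx x w)) ->
  (forall x w : R, 0 <= w -> is_derive x 1 (fx ^~ w) (fxx x w)) ->
  (forall x w : R, 0 <= w -> is_derive x 1 (fxx ^~ w) (fxxx x w)) ->
  (forall x w : R, 0 <= w -> is_derive w 1 (phi x) (fw x w)) ->
  (forall x w : R, 0 <= w -> is_derive w 1 (fw x) (fww x w)) ->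
  (forall x w : R, 0 <= w -> is_derive w 1 (fww x) (fwww x w)) ->
  locally_bounded fxxx -> locally_bounded fww -> locally_bounded fwww ->
  consistent lam phi (fun x w => fxx x w + 4 * w * fww x w + (2 + 4 * lam) * fw x w).
Proof.
move=> dx1 dx2 dx3 dw1 dw2 dw3 bx bw2 bw3 rho.
have [Cx hCx] := bx (rho + 1); have [C2 hC2] := bw2 (rho + 1).
have [C3 hC3] := bw3 (rho + 1).
exists (Cx + 4 * rho * C3 + `|2 + 4 * lam| * C2) => h x w /andP[h0 h1] xr /andP[w0 wr] wh.
have hh : h != 0 by rewrite gt_eqF.
have ineq y : x - h <= y <= x + h -> `|y| <= rho + 1.
  move=> yx; have : `|y - x| <= 1 by rewrite ler_norml; lra.
  by have := ler_normD (y - x) x; rewrite subrK; lra.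
have E1 : `|(phi (x + h) w + phi (x - h) w - 2 * phi x w) / h ^+ 2 - fxx x w| <= Cx * h.
  have : `|phi (x + h) w + phi (x - h) w - 2 * phi x w - h ^+ 2 * fxx x w| <= Cx * h ^+ 3.
    apply: (@second_difference R (phi ^~ w) (fx ^~ w) (fxx ^~ w) (fxxx ^~ w)); rewrite ?ltW //.
    - by move=> y _; exact: dx1.
    - by move=> y _; exact: dx2.
    - by move=> y _; exact: dx3.
    - by move=> y /ineq yr; apply: hCx => //; lra.
  set N := phi (x + h) w + _ - _ => hN.
  have -> : N / h ^+ 2 - fxx x w = (N - h ^+ 2 * fxx x w) / h ^+ 2 by field.
  rewrite normrM normfV [`|h ^+ 2|]ger0_norm ?sqr_ge0 // ler_pdivrMr ?exprn_gt0 //.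
  by rewrite -[Cx * h * _]mulrA -exprS.
have E3 : `|(phi x (w + h) - phi x w) / h - fw x w| <= C2 * h.
  have : `|phi x (w + h) - phi x w - h * fw x w| <= C2 * h ^+ 2.
    apply: (@first_difference R (phi x) (fw x) (fww x)); rewrite ?ltW //.
    - by move=> y yw; apply: dw1; lra.
    - by move=> y yw; apply: dw2; lra.
    - by move=> y yw; apply: hC2; lra.
  set N := phi x (w + h) - _ => hN.
  have -> : N / h - fw x w = (N - h * fw x w) / h by field.
  by rewrite normrM normfV [`|h|]gtr0_norm // ler_pdivrMr // -[C2 * h * _]mulrA -expr2.
have E2 : `|4 * w * ((phi x (w + h) + phi x (w - h) - 2 * phi x w) / h ^+ 2 - fww x w)|
    <= 4 * rho * C3 * h.
  have C30 : 0 <= C3 by apply: le_trans (hC3 0 0 _ _); rewrite ?normr_ge0 ?normr0 //; lra.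
  case: wh => [w_0|hw].
    rewrite w_0 mulr0 mul0r normr0 mulr_ge0 ?(ltW h0) // mulr_ge0 //; lra.
  have : `|phi x (w + h) + phi x (w - h) - 2 * phi x w - h ^+ 2 * fww x w| <= C3 * h ^+ 3.
    apply: (@second_difference R (phi x) (fw x) (fww x) (fwww x)); rewrite ?ltW //.
    - by move=> y yw; apply: dw1; lra.
    - by move=> y yw; apply: dw2; lra.
    - by move=> y yw; apply: dw3; lra.
    - by move=> y yw; apply: hC3; lra.
  set N := phi x (w + h) + _ - _ => hN.
  have -> : N / h ^+ 2 - fww x w = (N - h ^+ 2 * fww x w) / h ^+ 2 by field.
  rewrite normrM [`|4 * w|]ger0_norm; last lra.
  rewrite -[4 * rho * C3 * h]mulrA ler_pM ?normr_ge0 //; try lra.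
  rewrite normrM normfV [`|h ^+ 2|]ger0_norm ?sqr_ge0 // ler_pdivrMr ?exprn_gt0 //.
  by rewrite -[C3 * h * _]mulrA -exprS.
set e1 := _ / h ^+ 2 - _ in E1; set e2 := 4 * w * (_ - _) in E2; set e3 := _ / h - _ in E3.
have -> : discrete_op lam h phi x w - (fxx x w + 4 * w * fww x w + (2 + 4 * lam) * fw x w) =
   e1 + e2 + (2 + 4 * lam) * e3 by rewrite /discrete_op /e1 /e2 /e3; ring.
apply: le_trans (ler_normD _ _) _; rewrite [X in _ <= X]mulrDl lerD //.
  by apply: le_trans (ler_normD _ _) _; rewrite [X in _ <= X]mulrDl lerD.
by rewrite normrM -mulrA ler_wpM2l.
Qed.
End Bounded.

(** * Approximate fundamental solutions *)

Section Potential.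
Variables (R : realType) (a b lam : R).
Hypothesis b0 : 0 < b.
Let mn := monomial a b (- lam).

Fixpoint monomial_dx (k i j p : nat) (x w : R) : R :=
  if k is k'.+1 then i%:R * monomial_dx k' i.-1 j p x w
                     + 2 * (- lam - p%:R) * monomial_dx k' i.+1 j p.+1 x w
  else mn i j p x w.

Fixpoint monomial_dw (k i j p : nat) (x w : R) : R :=
  if k is k'.+1 then j%:R * monomial_dw k' i j.-1 p x w
                     + (- lam - p%:R) * monomial_dw k' i j p.+1 x w
  else mn i j p x w.

Lemma is_derive_monomial_dx k i j p (x w : R) : 0 <= w ->
  is_derive x 1 (monomial_dx k i j p ^~ w) (monomial_dx k.+1 i j p x w).
Proof.
move=> w0; elim: k i p => [|k IH] i p; first exact: is_derive_monomial_x.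
have := is_deriveD (is_deriveZ i%:R (IH i.-1 p))
                   (is_deriveZ (2 * (- lam - p%:R)) (IH i.+1 p.+1)).
exact.
Qed.

Lemma is_derive_monomial_dw k i j p (x w : R) : 0 <= w ->
  is_derive w 1 (monomial_dw k i j p x) (monomial_dw k.+1 i j p x w).
Proof.
move=> w0; elim: k j p => [|k IH] j p; first exact: is_derive_monomial_w.
have := is_deriveD (is_deriveZ j%:R (IH j.-1 p))
                   (is_deriveZ (- lam - p%:R) (IH j p.+1)).
exact.
Qed.

Lemma monomial_dx_bounded k i j p : locally_bounded (monomial_dx k i j p).
Proof.
elim: k i p => [|k IH] i p; first exact: monomial_bounded.
by apply: locally_boundedD; apply: locally_boundedZ.
Qed.

Lemma monomial_dw_bounded k i j p : locally_bounded (monomial_dw k i j p).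
Proof.
elim: k j p => [|k IH] j p; first exact: monomial_bounded.
by apply: locally_boundedD; apply: locally_boundedZ.
Qed.

Lemma monomial_consistent i j p : consistent lam (mn i j p)
  (fun x w => monomial_dx 2 i j p x w + 4 * w * monomial_dw 2 i j p x w
              + (2 + 4 * lam) * monomial_dw 1 i j p x w).
Proof.
apply: (@consistent_derive R lam _ (monomial_dx 1 i j p) (monomial_dx 2 i j p)
  (monomial_dx 3 i j p) (monomial_dw 1 i j p) (monomial_dw 2 i j p) (monomial_dw 3 i j p)).
all: try (by move=> x w; exact: is_derive_monomial_dx).
all: try (by move=> x w; exact: is_derive_monomial_dw).
- by move=> x w; exact: (@is_derive_monomial_dx 0).
- by move=> x w; exact: (@is_derive_monomial_dw 0).
- exact: monomial_dx_bounded.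
all: exact: monomial_dw_bounded.
Qed.

(** For [w ^ j Q ^ s] the terms in [w ^ j Q ^ (s - 1)] have total coefficient [4 s (s + 2 j + lam)].
    The exponent [s = - lam - 2 j] makes them vanish, and the two remaining terms match those of the
    neighbouring indices. *)
Lemma monomial_op j x w : 0 <= w ->
  monomial_dx 2 0 j j.*2 x w + 4 * w * monomial_dw 2 0 j j.*2 x w
    + (2 + 4 * lam) * monomial_dw 1 0 j j.*2 x w =
  - (4 * (lam + 2 * j%:R) * (lam + 2 * j%:R + 1) * b ^+ 2) * mn 0 j j.*2.+2 x w
  + 2 * j%:R * (2 * j%:R - 1 + 2 * lam) * mn 0 j.-1 j.*2 x w.
Proof.
move=> w0; rewrite /= /mn /monomial.
rewrite (powR_monomial_shift _ _ b0 _ _ w0) !(powR_monomial_shift _ _ b0 _ j.*2.+1 w0).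
have -> : j.*2.+1%:R = 2 * j%:R + 1 :> R by rewrite -muln2 -natr1 natrM; ring.
have -> : j.*2%:R = 2 * j%:R :> R by rewrite -muln2 natrM mulrC.
set Z := _ `^ _; rewrite /quad.
case: j @Z => [|[|j]] Z /=; rewrite ?exprS -?natr1; ring.
Qed.

(* The recurrence makes the images of consecutive terms of [potential] under the
   operator cancel, up to the last one, [- charge_density]. *)
Fixpoint kappa (j : nat) : R :=
  if j is j'.+1 then kappa j' * ((lam + 2 * j'%:R) * (lam + 2 * j'%:R + 1)
     / ((2 * j'%:R + 2) * (2 * j'%:R + 1 + 2 * lam))) else 1.

(** This is [Q ^ (- lam)] times a truncation of the hypergeometric series [2F1 (lam / 2, (lam + 1) /
    2; lam + 1 / 2; z)] at [z = 4 b ^ 2 w / Q ^ 2]. The third parameter is the sum of the other two,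
    whence the logarithmic singularity of the full series at [z = 1], that is, at the pole. *)
Definition potential (J : nat) (x w : R) :=
  \sum_(j < J.+1) kappa j * (4 * b ^+ 2) ^+ j * mn 0 j j.*2 x w.

Definition charge_density (J : nat) (x w : R) :=
  4 * (kappa J * (lam + 2 * J%:R) * (lam + 2 * J%:R + 1)) * b ^+ 2
    * (4 * b ^+ 2) ^+ J * mn 0 J J.*2.+2 x w.

Lemma kappaS j : 0 < lam -> kappa j.+1 * ((2 * j%:R + 2) * (2 * j%:R + 1 + 2 * lam)) =
  kappa j * ((lam + 2 * j%:R) * (lam + 2 * j%:R + 1)).
Proof.
move=> lam0; have j0 : 0 <= j%:R :> R by [].
rewrite /= -mulrA mulfVK // mulf_neq0 // gt_eqF //; lra.
Qed.

Lemma kappa_gt0 j : 0 < lam -> 0 < kappa j.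
Proof.
move=> lam0; elim: j => //= j IH; have j0 : 0 <= j%:R :> R by [].
by rewrite mulr_gt0 // divr_gt0 // mulr_gt0 //; lra.
Qed.

Lemma consistent_eq (phi psi psi' : R -> R -> R) :
  (forall x w, 0 <= w -> psi x w = psi' x w) -> consistent lam phi psi -> consistent lam phi psi'.
Proof.
move=> e c rho; have [C h] := c rho; exists C => t x w t1 xr wr wt.
by rewrite -e ?h //; case/andP: wr.
Qed.

Lemma potential_consistent J : 0 < lam ->
  consistent lam (potential J) (fun x w => - charge_density J x w).
Proof.
move=> lam0; elim: J => [|J IH].
  have -> : potential 0 = mn 0 0 0.
    by apply/funext => x; apply/funext => w; rewrite /potential big_ord1 /= expr0 !mul1r.
  apply: (consistent_eq _ (monomial_consistent 0 0 0)) => x w w0.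
  by rewrite (monomial_op 0) // /charge_density /=; ring.
have -> : potential J.+1 = (fun x w => potential J x w +
     kappa J.+1 * (4 * b ^+ 2) ^+ J.+1 * mn 0 J.+1 J.+1.*2 x w).
  by apply/funext => x; apply/funext => w; rewrite /potential big_ord_recr.
apply: consistent_eq _ (consistentD IH (consistentZ _ (monomial_consistent _ _ _))) => x w w0.
rewrite monomial_op // /charge_density (exprS _ J) doubleS.
have -> : 2 * J.+1%:R * (2 * J.+1%:R - 1 + 2 * lam) = (2 * J%:R + 2) * (2 * J%:R + 1 + 2 * lam).
  by rewrite -natr1; ring.
set m1 := mn _ _ _ _ _; set m2 := mn _ _ _ _ _.
transitivity (m1 * (4 * b ^+ 2 * (4 * b ^+ 2) ^+ J) *
    (kappa J.+1 * ((2 * J%:R + 2) * (2 * J%:R + 1 + 2 * lam))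
     - kappa J * ((lam + 2 * J%:R) * (lam + 2 * J%:R + 1)))
   - 4 * (kappa J.+1 * (lam + 2 * J.+1%:R) * (lam + 2 * J.+1%:R + 1)) * b ^+ 2 *
     (4 * b ^+ 2 * (4 * b ^+ 2) ^+ J) * m2).
  by ring.
by rewrite kappaS // subrr mulr0 sub0r.
Qed.
End Potential.

Lemma expr_eventually_le (R : realType) (th eps : R) : 0 <= th < 1 -> 0 < eps ->
  exists J0, forall J, (J0 <= J)%N -> th ^+ J <= eps.
Proof.
move=> /andP[th0 th1] eps0.
have /cvgr0Pnorm_le/(_ eps eps0)[J0 _ hJ] : th ^+ n @[n --> \oo] --> 0.
  by apply: cvg_expr; rewrite ger0_norm.
by exists J0 => J /hJ /=; rewrite ger0_norm // exprn_ge0.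
Qed.

Lemma bernoulli (R : realType) (om : R) n : 0 <= om <= 1 ->
  1 - n%:R * (1 - om) <= om ^+ n.
Proof.
move=> /andP[om0 om1]; elim: n => [|n IH]; first by rewrite mul0r subr0.
have n0 : 0 <= n%:R :> R by [].
have : om * (1 - n%:R * (1 - om)) <= om * om ^+ n by rewrite ler_wpM2l.
rewrite -exprS; apply: le_trans; rewrite -natr1.
have -> : om * (1 - n%:R * (1 - om)) = 1 - (n%:R + 1) * (1 - om) + n%:R * (1 - om) ^+ 2 by ring.
by rewrite lerDl mulr_ge0 // sqr_ge0.
Qed.

(** * Growth of the coefficients of the series *)

Section KappaSums.
Variables (R : realType) (lam : R).
Notation kappa := (@kappa R lam).

Definition kappa2 j := kappa j * (lam + 2 * j%:R) * (lam + 2 * j%:R + 1).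

Lemma kappa2_gt0 (lam0 : 0 < lam) j : 0 < kappa2 j.
Proof.
have j0 : 0 <= j%:R :> R by [].
by rewrite /kappa2 !mulr_gt0 ?kappa_gt0 //; lra.
Qed.

(** The ratio of consecutive terms is a quotient of two quadratics in [j] with the same leading
    coefficient, so it tends to [1]. *)
Lemma kappa2S_le (lam0 : 0 < lam) q : 1 < q -> exists j0, forall j, (j0 <= j)%N ->
  kappa2 j.+1 <= q * kappa2 j.
Proof.
(* For [2 t >= 1] the product [(lam + 2 t + 2) (lam + 2 t + 3)] exceeds [(2 t) ^ 2] by at most
   [K (2 t)], and beyond [j0] one has [K <= (q - 1) (2 t)]. *)
move=> q1; pose K := 2 * lam + 5 + (lam + 2) * (lam + 3).
pose j0 := (Num.bound (K / (q - 1))).+1.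
have l2 := mulr_gt0 lam0 lam0.
have K0 : 0 < K by rewrite /K; lra.
exists j0 => j j0j; have jR0 : 0 <= j%:R :> R by [].
have d0 : 0 < (2 * j%:R + 2) * (2 * j%:R + 1 + 2 * lam) by apply: mulr_gt0; lra.
have E : kappa2 j.+1 * ((2 * j%:R + 2) * (2 * j%:R + 1 + 2 * lam)) =
    kappa2 j * ((lam + 2 * j%:R + 2) * (lam + 2 * j%:R + 3)).
  transitivity (kappa j.+1 * ((2 * j%:R + 2) * (2 * j%:R + 1 + 2 * lam)) *
     ((lam + 2 * j%:R + 2) * (lam + 2 * j%:R + 3))).
    by rewrite /kappa2 -natr1; ring.
  by rewrite kappaS // /kappa2; ring.
rewrite -(ler_pM2r d0) E.
rewrite [leRHS]mulrAC [leRHS]mulrC ler_pM2l ?kappa2_gt0 //.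
have Kj : K <= (q - 1) * (2 * j%:R).
  have : K / (q - 1) < j%:R.
    apply: lt_le_trans (archi_boundP _) _; first by apply: divr_ge0; lra.
    by rewrite ler_nat; apply: leq_trans j0j; exact: leqnSn.
  rewrite ltr_pdivrMr ?subr_gt0 // => Kj; lra.
have j1 : 1 <= j%:R :> R by rewrite ler1n; apply: leq_trans j0j.
move: (j%:R : R) Kj jR0 j1 => t Kt t0 t1.
have h1 : (lam + 2 * t + 2) * (lam + 2 * t + 3) <= (2 * t) ^+ 2 + K * (2 * t).
  have P0 : 0 <= (lam + 2) * (lam + 3) * (2 * t - 1) by apply: mulr_ge0; [apply: mulr_ge0|]; lra.
  rewrite -subr_ge0; apply: le_trans P0 _; rewrite le_eqVlt; apply/orP; left; apply/eqP.
  by rewrite /K; ring.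
have h2 : K * (2 * t) <= (q - 1) * (2 * t) * (2 * t) by rewrite ler_wpM2r //; lra.
have h3 : q * (2 * t) ^+ 2 <= q * ((2 * t + 2) * (2 * t + 1 + 2 * lam)).
  rewrite ler_wpM2l //; first lra.
  have := mulr_ge0 (ltW lam0) t0; have := mulr_ge0 t0 t0; lra.
apply: le_trans h1 _; apply: le_trans h3.
have -> : q * (2 * t) ^+ 2 = (2 * t) ^+ 2 + (q - 1) * (2 * t) * (2 * t) by ring.
by rewrite lerD2l.
Qed.

(** With [th'] midway between [th] and [1], the slack [th' / th > 1] beats the growth of [kappa2]:
    the sequence [kappa2 j * (th / th') ^ j] is eventually nonincreasing, hence bounded. *)
Lemma kappa2_geometric (lam0 : 0 < lam) th : 0 < th < 1 ->
  exists B th', [/\ 0 <= B, 0 < th' < 1 & forall j, kappa2 j * th ^+ j <= B * th' ^+ j].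
Proof.
move=> /andP[th0 th1]; pose th' := (th + 1) / 2.
have th'0 : 0 < th' by rewrite /th'; lra.
have q1 : 1 < th' / th by rewrite ltr_pdivlMr // mul1r /th'; lra.
have [j0 hj0] := kappa2S_le lam0 q1.
pose c j := kappa2 j * (th / th') ^+ j.
have c0 j : 0 <= c j by rewrite mulr_ge0 ?(ltW (kappa2_gt0 lam0 _)) // exprn_ge0 // divr_ge0 // ltW.
have cS j : (j0 <= j)%N -> c j.+1 <= c j.
  move=> /hj0 h; rewrite /c exprS mulrA; apply: ler_wpM2r.
    by rewrite exprn_ge0 // divr_ge0 // ltW.
  have -> : kappa2 j = th' / th * kappa2 j * (th / th').
    by field; rewrite !gt_eqF.
  by apply: ler_wpM2r => //; rewrite divr_ge0 // ltW.
pose B := \sum_(i < j0.+1) c i.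
have cB j : c j <= B.
  have cle i : (i <= j0)%N -> c i <= B.
    move=> ij; rewrite /B (bigD1 (Ordinal (ij : (i < j0.+1)%N))) //= lerDl.
    by apply: sumr_ge0 => *; exact: c0.
  elim: j => [|j IH]; first exact: cle.
  by have [jj|jj] := leqP j.+1 j0; [exact: cle|apply: le_trans (cS _ _) IH].
exists B, th'; split.
- by apply: le_trans (cB 0%N); exact: c0.
- by rewrite th'0 /th'; lra.
- move=> j; have := cB j; rewrite /c expr_div_n mulrA ler_pdivrMr ?exprn_gt0 //.
Qed.

Lemma kappa_sum_bounded (lam0 : 0 < lam) th : 0 < th < 1 ->
  exists B, forall J, \sum_(j < J) kappa j * th ^+ j <= B.
Proof.
move=> th01; have [B [th' [B0 /andP[t0 t1] h]]] := kappa2_geometric lam0 th01.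
case/andP: th01 => th0 _.
exists (B / (lam * (lam + 1)) * (1 - th')^-1) => J.
have l0 : 0 < lam * (lam + 1) by rewrite mulr_gt0 // addr_gt0.
have le j : kappa j * th ^+ j <= B / (lam * (lam + 1)) * th' ^+ j.
  rewrite [leRHS]mulrAC ler_pdivlMr //; apply: le_trans (h j).
  rewrite mulrAC ler_wpM2r ?exprn_ge0 ?(ltW th0) // /kappa2 -mulrA.
  have j0 : 0 <= j%:R :> R by [].
  by rewrite ler_wpM2l ?(ltW (kappa_gt0 _ _)) // ler_pM //; lra.
apply: (@le_trans _ _ (\sum_(j < J) B / (lam * (lam + 1)) * th' ^+ j)).
  by apply: ler_sum => j _; exact: le.
rewrite -mulr_sumr ler_wpM2l ?divr_ge0 ?(ltW l0) //.
rewrite -[leRHS]mul1r ler_pdivlMr ?subr_gt0 //.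
have := subrX1 th' J; have := exprn_ge0 J (ltW t0); set S := \sum_(_ < _) _; lra.
Qed.

(** For small [A > 0] the sequence [kappa j * (j + A)] is nondecreasing, so the terms dominate a
    multiple of the harmonic series. This divergence makes the potential large at its pole. *)
Lemma kappa_sum_unbounded (lam0 : 0 < lam) M : exists J, M <= \sum_(j < J) kappa j.
Proof.
apply: contrapT => /forallNP bnd.
pose A := Num.min (lam / 4) 1.
have A0 : 0 < A by rewrite lt_min ltr01 divr_gt0.
have A1 : A <= 1 by rewrite ge_min lexx orbT.
have A4 : A <= lam / 4 by rewrite ge_min lexx.
have kA j : A / (j%:R + 1) <= kappa j.
  suff : A <= kappa j * (j%:R + A).
    rewrite ler_pdivrMr ?ltr_wpDl // => /le_trans; apply.
    by rewrite ler_wpM2l ?(ltW (kappa_gt0 _ _)) // lerD2l.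
  elim: j => [|j IH]; first by rewrite /= mul1r add0r.
  apply: le_trans IH _; have t0 : 0 <= j%:R :> R by [].
  have d0 : 0 < (2 * j%:R + 2) * (2 * j%:R + 1 + 2 * lam) by apply: mulr_gt0; lra.
  rewrite -(ler_pM2r d0) [leRHS]mulrAC kappaS // -!mulrA ler_pM2l ?kappa_gt0 //.
  rewrite -[j.+1%:R]natr1; move: (j%:R : R) t0 {d0} => t t0.
  rewrite -subr_ge0.
  rewrite [X in 0 <= X](_ : _ =
     t * (lam - 4 * A) + t * lam ^+ 2
     + (lam + lam ^+ 2 + lam ^+ 2 * A - 2 * A - 3 * lam * A)); last by ring.
  have h1 : 0 <= t * (lam - 4 * A) by rewrite mulr_ge0 //; lra.
  have h2 : 0 <= t * lam ^+ 2 by rewrite mulr_ge0 // sqr_ge0.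
  have h3 : 0 <= lam * (lam - 4 * A) by rewrite mulr_ge0 //; lra.
  have h4 : 0 <= lam ^+ 2 * A by rewrite mulr_ge0 ?sqr_ge0 // ltW.
  have h5 : 0 <= lam * A by rewrite mulr_ge0 // ltW.
  by apply: addr_ge0; [exact: addr_ge0|lra].
apply: (@dvg_harmonic R); apply: nondecreasing_is_cvgn.
  apply/nondecreasing_seqP => n; rewrite seriesEord /= big_ord_recr /= lerDl.
  by rewrite invr_ge0.
exists (M / A) => _ [n _ <-]; rewrite seriesEord /= ler_pdivlMr // mulr_suml.
have /negP := bnd n; rewrite -ltNge => /ltW; apply: le_trans.
by apply: ler_sum => i _; apply: le_trans (kA i); rewrite /harmonic /= mulrC natr1.
Qed.
End KappaSums.

(** * Bounds near and away from a pole, uniform in the order of truncation *)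

Section PoleEstimates.
Variables (R : realType) (a b lam : R).
Notation Q := (quad a b).
Notation pot := (potential a b lam).
Notation chg := (charge_density a b lam).

(* [1 / cosh^2] of the hyperbolic distance from [(x, sqrt w)] to the pole. *)
Definition inv_cosh2 (x w : R) := 4 * b ^+ 2 * w / Q x w ^+ 2.
Notation om := inv_cosh2.

Lemma monomial_even (b0 : 0 < b) (j : nat) (x w : R) : 0 <= w ->
  (4 * b ^+ 2) ^+ j * monomial a b (- lam) 0 j j.*2 x w = Q x w `^ (- lam) * om x w ^+ j.
Proof.
move=> w0; have q0 := quad_gt0 a b0 x w0; rewrite /monomial /inv_cosh2 expr0 mul1r.
rewrite powRB; last by rewrite (gt_eqF q0) implybT.
rewrite (powR_mulrn _ (ltW q0)) -muln2 mulnC exprM.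
by rewrite expr_div_n [(_ * w) ^+ j]exprMn; ring.
Qed.

Lemma potentialE (b0 : 0 < b) J (x w : R) : 0 <= w ->
  pot J x w = Q x w `^ (- lam) * \sum_(j < J.+1) kappa lam j * om x w ^+ j.
Proof.
move=> w0; rewrite /potential mulr_sumr; apply: eq_bigr => j _.
by rewrite -mulrA (monomial_even b0) // mulrCA.
Qed.

Lemma charge_densityE (b0 : 0 < b) J (x w : R) : 0 <= w ->
  chg J x w = 4 * b ^+ 2 * (Q x w `^ (- lam) / Q x w ^+ 2) * (kappa2 lam J * om x w ^+ J).
Proof.
move=> w0; have q0 := quad_gt0 a b0 x w0.
have E : monomial a b (- lam) 0 J J.*2.+2 x w = monomial a b (- lam) 0 J J.*2 x w / Q x w ^+ 2.
  rewrite /monomial (powR_monomial_shift _ _ b0 _ J.*2 w0).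
  rewrite (powR_monomial_shift _ _ b0 _ J.*2.+1 w0).
  by field; rewrite gt_eqF.
rewrite /charge_density E -/(kappa2 lam J).
transitivity (4 * kappa2 lam J * b ^+ 2 *
    ((4 * b ^+ 2) ^+ J * monomial a b (- lam) 0 J J.*2 x w) / Q x w ^+ 2).
  by ring.
by rewrite (monomial_even b0) //; ring.
Qed.

Lemma potential_axis J (x : R) : pot J x 0 = ((x - a) ^+ 2 + b ^+ 2) `^ (- lam).
Proof.
rewrite /potential big_ord_recl big1 => [|j _].
  by rewrite /monomial /quad /= !expr0 subr0 !addr0 !mul1r.
by rewrite /monomial /= [0 ^+ _]expr0n /= mulr0 mul0r mulr0.
Qed.

Lemma four_sqr_ge0 : 0 <= 4 * b ^+ 2.
Proof. by rewrite mulr_ge0 // sqr_ge0. Qed.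

Lemma inv_cosh2_ge0 x w : 0 <= w -> 0 <= om x w.
Proof. by move=> w0; rewrite /om divr_ge0 ?sqr_ge0 // mulr_ge0 // four_sqr_ge0. Qed.

Lemma one_sub_inv_cosh2 (b0 : 0 < b) (x w : R) : 0 <= w ->
  1 - om x w = (((x - a) ^+ 2 + w - b ^+ 2) ^+ 2 + 4 * b ^+ 2 * (x - a) ^+ 2) / Q x w ^+ 2.
Proof.
move=> w0; have q0 := quad_gt0 a b0 x w0.
by rewrite /om; move: q0; rewrite /quad => q0; field; rewrite gt_eqF.
Qed.

Lemma inv_cosh2_le1 (b0 : 0 < b) (x w : R) : 0 <= w -> om x w <= 1.
Proof.
move=> w0; rewrite -subr_ge0 one_sub_inv_cosh2 // mulr_ge0 ?invr_ge0 ?sqr_ge0 //.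
by rewrite addr_ge0 ?sqr_ge0 // mulr_ge0 ?four_sqr_ge0 ?sqr_ge0.
Qed.

Lemma potential_ge0 (b0 : 0 < b) (lam0 : 0 < lam) J (x w : R) : 0 <= w -> 0 <= pot J x w.
Proof.
move=> w0; rewrite potentialE // mulr_ge0 ?powR_ge0 // sumr_ge0 // => j _.
by rewrite mulr_ge0 ?(ltW (kappa_gt0 _ _)) // exprn_ge0 ?inv_cosh2_ge0.
Qed.

Lemma charge_density_ge0 (b0 : 0 < b) (lam0 : 0 < lam) J (x w : R) : 0 <= w -> 0 <= chg J x w.
Proof.
move=> w0; rewrite charge_densityE //.
apply: mulr_ge0; first apply: mulr_ge0; first exact: four_sqr_ge0.
  by rewrite divr_ge0 ?sqr_ge0 ?powR_ge0.
by rewrite mulr_ge0 ?(ltW (kappa2_gt0 _ _)) // exprn_ge0 ?inv_cosh2_ge0.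
Qed.

Lemma powRN_le (lam0 : 0 < lam) (s t : R) : 0 < s -> s <= t -> t `^ (- lam) <= s `^ (- lam).
Proof.
move=> s0 st; rewrite !powRN lef_pV2 ?posrE ?powR_gt0 //; last exact: lt_le_trans st.
by rewrite ge0_ler_powR ?nnegrE ?(ltW lam0) ?(ltW s0) // (le_trans _ st) // ltW.
Qed.

Lemma potential_le (b0 : 0 < b) (lam0 : 0 < lam) (th : R) : 0 < th < 1 ->
  exists2 B, 0 < B & forall J x w, 0 <= w -> om x w <= th -> pot J x w <= Q x w `^ (- lam) * B.
Proof.
move=> th01; have [B hB] := kappa_sum_bounded lam0 th01.
exists (`|B| + 1) => [|J x w w0 omth]; first by rewrite ltr_wpDl.
rewrite potentialE // ler_wpM2l ?powR_ge0 //.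
apply: le_trans (ler_wpDr ler01 (ler_norm B)); apply: le_trans (hB J.+1).
apply: ler_sum => j _; rewrite ler_wpM2l ?(ltW (kappa_gt0 _ _)) //.
by rewrite lerXn2r ?nnegrE ?inv_cosh2_ge0 //; case/andP: th01 => /ltW.
Qed.

Lemma potential_small_at_infinity (b0 : 0 < b) (lam0 : 0 < lam) (eps : R) : 0 < eps ->
  exists rho0, forall J x w, 0 <= w -> rho0 <= `|x| \/ rho0 <= w -> pot J x w <= eps.
Proof.
move=> eps0; have [|B B0 hB] := potential_le b0 lam0 (th := 1/2); first lra.
(* The solution of [q0 ^ (- lam) * B = eps]. *)
pose q0 := (B / eps) `^ (lam^-1).
have q00 : 0 < q0 by rewrite powR_gt0 // divr_gt0.
have q0B s : q0 <= s -> s `^ (- lam) * B <= eps.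
  move=> q0s; apply: le_trans (ler_wpM2r (ltW B0) (powRN_le lam0 q00 q0s)) _.
  rewrite /q0 -powRrM mulrN mulVf ?(lt0r_neq0 lam0) // (powR_inv1 (ltW (divr_gt0 B0 eps0))).
  by rewrite invf_div divfK ?lexx ?(lt0r_neq0 B0).
(* Since [w <= Q], the condition [Q >= 8 b ^ 2] gives [inv_cosh2 <= 4 b ^ 2 / Q <= 1 / 2], the value
   of [th] chosen above. *)
pose q1 := q0 + 8 * b ^+ 2.
exists (`|a| + q1 + 1) => J x w w0 xw.
have b20 : 0 <= b ^+ 2 by rewrite sqr_ge0.
have a0 := normr_ge0 a.
have Qq : q1 <= Q x w.
  rewrite /quad; case: xw => [xr|wr]; last by have := sqr_ge0 (x - a); lra.
  have xa : q1 + 1 <= `|x - a| by have := ler_normD (x - a) a; rewrite subrK; lra.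
  have : (q1 + 1) ^+ 2 <= `|x - a| ^+ 2 by rewrite lerXn2r ?nnegrE //; rewrite /q1; lra.
  rewrite real_normK ?num_real // => h.
  have : q1 <= (q1 + 1) ^+ 2 by have := sqr_ge0 q1; rewrite sqrrD1; rewrite /q1; lra.
  lra.
have Q0 := quad_gt0 a b0 x w0.
apply: le_trans (hB J x w w0 _) (q0B _ _); last by rewrite /q1 in Qq; lra.
rewrite /om ler_pdivrMr ?exprn_gt0 //.
have wQ : w <= Q x w by rewrite /quad; have := sqr_ge0 (x - a); lra.
have h1 : 4 * b ^+ 2 * w <= 4 * b ^+ 2 * Q x w by rewrite ler_wpM2l // mulr_ge0.
have h2 : 8 * b ^+ 2 * Q x w <= Q x w * Q x w by rewrite ler_pM2r //; rewrite /q1 in Qq; lra.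
by rewrite expr2; lra.
Qed.

Definition in_box (r x w : R) := (`|x - a| <= r) && (`|w - b ^+ 2| <= r).

Lemma inv_cosh2_off_box (b0 : 0 < b) r rho : 0 < r ->
  exists2 th, 0 < th < 1 & forall x w, `|x| <= rho -> 0 <= w <= rho ->
    ~~ in_box r x w -> om x w <= th.
Proof.
(* With [r' <= 1/2], [|x - a| < r'] implies [(x - a) ^ 2 <= r' / 2]; then [|w - b ^ 2| > r'] keeps
   [(x - a) ^ 2 + w - b ^ 2] at distance at least [r' / 2] from zero. The two entries of [k] serve
   this case and the case [|x - a| >= r']. *)
move=> r0; pose r' := Num.min r (1/2).
have r'0 : 0 < r' by rewrite lt_min r0; lra.
have r'r : r' <= r by rewrite ge_min lexx.
have r'1 : r' <= 1/2 by rewrite ge_min lexx orbT.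
have b20 : 0 < b ^+ 2 by rewrite exprn_gt0.
pose k := Num.min (1/4) (4 * b ^+ 2).
have k0 : 0 < k by rewrite lt_min; apply/andP; split; lra.
have k1 : k <= 1/4 by rewrite ge_min lexx.
have k2 : k <= 4 * b ^+ 2 by rewrite ge_min lexx orbT.
pose M := (rho + `|a|) ^+ 2 + rho + b ^+ 2.
pose th := Num.max (1/2) (1 - r' ^+ 2 * k / M ^+ 2).
have r'2 : 0 < r' ^+ 2 by rewrite exprn_gt0.
have thm : 1/2 <= th by rewrite le_max lexx.
have thm2 : 1 - r' ^+ 2 * k / M ^+ 2 <= th by rewrite le_max lexx orbT.
have [rho0|rho0] := ltP rho 0.
  exists (1/2) => [|x w xr]; first lra.
  by have := normr_ge0 x; lra.
have M0 : 0 < M by rewrite /M; have := sqr_ge0 (rho + `|a|); lra.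
exists th.
  have : 0 < r' ^+ 2 * k / M ^+ 2 by rewrite divr_gt0 ?exprn_gt0 // mulr_gt0.
  by move=> h; rewrite gt_max; apply/and3P; split; lra.
move=> x w xr /andP[w0 wr] nbox.
have Q0 := quad_gt0 a b0 x w0.
have QM : Q x w <= M.
  rewrite /quad /M lerD2r lerD // -[_ ^+ 2]ger0_norm ?sqr_ge0 // normrX.
  rewrite lerXn2r ?nnegrE ?addr_ge0 ?normr_ge0 //.
  by apply: le_trans (ler_normB _ _) _; rewrite lerD2r.
suff D : r' ^+ 2 * k <= ((x - a) ^+ 2 + w - b ^+ 2) ^+ 2 + 4 * b ^+ 2 * (x - a) ^+ 2.
  apply: le_trans thm2.
  rewrite lerBrDl -lerBrDr one_sub_inv_cosh2 //.
  apply: ler_pM; rewrite ?invr_ge0 ?sqr_ge0 //.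
    by rewrite mulr_ge0 ?(ltW r'2) ?(ltW k0).
  by rewrite lef_pV2 ?posrE ?exprn_gt0 // lerXn2r ?nnegrE ?(ltW Q0) ?(ltW M0).
set X2 := (x - a) ^+ 2; have X20 : 0 <= X2 by rewrite sqr_ge0.
have [h|h] := leP r' `|x - a|.
  have r'X : r' ^+ 2 <= X2.
    by rewrite /X2 -[leRHS]real_normK ?num_real // lerXn2r ?nnegrE ?(ltW r'0).
  have := sqr_ge0 (X2 + w - b ^+ 2).
  have : k * r' ^+ 2 <= 4 * b ^+ 2 * X2 by apply: ler_pM => //; exact: ltW.
  lra.
have X2r : X2 <= r' / 2.
  have : `|x - a| ^+ 2 <= r' ^+ 2 by rewrite lerXn2r ?nnegrE ?(ltW r'0) // ltW.
  rewrite real_normK ?num_real // -/X2 expr2.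
  have : r' * r' <= r' * (1/2) by rewrite ler_pM2l.
  lra.
have wb : r' < `|w - b ^+ 2|.
  rewrite ltNge; apply: contra nbox => wb; rewrite /in_box.
  by rewrite (le_trans (ltW h) r'r) (le_trans wb r'r).
have : (r' / 2) ^+ 2 <= (X2 + w - b ^+ 2) ^+ 2.
  rewrite -[leRHS]real_normK ?num_real // lerXn2r ?nnegrE ?normr_ge0 //; first lra.
  by move: wb; rewrite ltr_normr => /orP[] wb; rewrite ler_normr; apply/orP; [left|right]; lra.
have : r' ^+ 2 * k <= r' ^+ 2 * (1/4) by rewrite ler_pM2l.
have := mulr_ge0 (ltW b20) X20.
by rewrite expr_div_n; lra.
Qed.

Lemma potential_bounded_off_box (b0 : 0 < b) (lam0 : 0 < lam) r rho : 0 < r ->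
  exists B, forall J x w, `|x| <= rho -> 0 <= w <= rho -> ~~ in_box r x w -> pot J x w <= B.
Proof.
move=> r0; have [th th01 hth] := inv_cosh2_off_box b0 rho r0.
have [B B0 hB] := potential_le b0 lam0 th01.
exists ((b ^+ 2) `^ (- lam) * B) => J x w xr wr nb; case/andP: (wr) => w0 _.
apply: le_trans (hB J x w w0 (hth x w xr wr nb)) _.
by rewrite ler_wpM2r ?(ltW B0) // powRN_le ?exprn_gt0 // quad_ge.
Qed.

Lemma charge_density_small_off_box (b0 : 0 < b) (lam0 : 0 < lam) r rho eps : 0 < r -> 0 < eps ->
  exists J0, forall J x w, (J0 <= J)%N -> `|x| <= rho -> 0 <= w <= rho -> ~~ in_box r x w ->
    chg J x w <= eps.
Proof.
move=> r0 eps0; have [th th01 hth] := inv_cosh2_off_box b0 rho r0.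
have [B [th' [B0 /andP[t0 t1] hB]]] := kappa2_geometric lam0 th01.
have b20 : 0 < b ^+ 2 by rewrite exprn_gt0.
pose K := 4 * b ^+ 2 * ((b ^+ 2) `^ (- lam) / (b ^+ 2) ^+ 2).
have K0 : 0 < K by rewrite !mulr_gt0 ?invr_gt0 ?exprn_gt0 ?powR_gt0.
have KB : 0 < K * (B + 1) by apply: mulr_gt0 => //; rewrite ltr_wpDl.
have [||J0 hJ0] := @expr_eventually_le R th' (eps / (K * (B + 1))).
- by rewrite (ltW t0).
- exact: divr_gt0.
exists J0 => J x w JJ xr wr nb; case/andP: (wr) => w0 _.
have Q0 := quad_gt0 a b0 x w0; have bQ := quad_ge a b x w0.
rewrite charge_densityE //; apply: (@le_trans _ _ (K * (B * th' ^+ J))); last first.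
  have := hJ0 J JJ; rewrite (ler_pdivlMr _ _ KB) => h.
  apply: le_trans h; rewrite mulrA [leRHS]mulrC.
  by apply: ler_wpM2r; [rewrite exprn_ge0 // ltW|rewrite (ler_pM2l K0) lerDl].
apply: ler_pM.
- by rewrite mulr_ge0 ?four_sqr_ge0 // divr_ge0 ?sqr_ge0 ?powR_ge0.
- by rewrite mulr_ge0 ?(ltW (kappa2_gt0 _ _)) // exprn_ge0 ?inv_cosh2_ge0.
- rewrite /K ler_pM2l ?mulr_gt0 //; apply: ler_pM; rewrite ?invr_ge0 ?sqr_ge0 ?powR_ge0 //.
    by rewrite powRN_le.
  by rewrite lef_pV2 ?posrE ?exprn_gt0 // lerXn2r ?nnegrE ?(ltW Q0) ?(ltW b20).
- apply: le_trans (hB J); rewrite ler_wpM2l ?(ltW (kappa2_gt0 _ _)) //.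
  rewrite lerXn2r ?nnegrE ?inv_cosh2_ge0 //; first by case/andP: th01 => /ltW.
  exact: hth.
Qed.

(** [J0] comes from the divergence of the sum of [kappa]; by Bernoulli's inequality
    [inv_cosh2 ^ J0 >= 1/2] on a small enough box, a loss made up for by the factor [2] in [hJ0].
    Further terms are nonnegative, so every [J >= J0] works on the same box. *)
Lemma potential_large_in_box (b0 : 0 < b) (lam0 : 0 < lam) M :
  exists r0 J0, 0 < r0 /\ forall J x w, (J0 <= J)%N -> 0 <= w -> in_box r0 x w -> M <= pot J x w.
Proof.
have b20 : 0 < b ^+ 2 by rewrite exprn_gt0.
pose Qm := 1 + (b ^+ 2 + 1) + b ^+ 2.
have Qm0 : 0 < Qm `^ (- lam) by rewrite powR_gt0 /Qm; lra.
have [J0 hJ0] := kappa_sum_unbounded lam0 (2 * (`|M| / Qm `^ (- lam))).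
pose c := (4 + 4 * b ^+ 2) / (b ^+ 2) ^+ 2.
have c0 : 0 < c by rewrite divr_gt0 ?exprn_gt0 //; lra.
pose r0 := Num.min 1 ((2 * c * (J0%:R + 1))^-1).
have J00 : 0 <= J0%:R :> R by [].
have cJ : 0 < 2 * c * (J0%:R + 1) by apply: mulr_gt0; [exact: mulr_gt0|rewrite ltr_wpDl].
have r00 : 0 < r0 by rewrite lt_min ltr01 invr_gt0.
have r01 : r0 <= 1 by rewrite ge_min lexx.
have r0c : r0 * (2 * c * (J0%:R + 1)) <= 1.
  by rewrite -ler_pdivlMr // div1r ge_min lexx orbT.
exists r0, J0; split => // J x w JJ w0 /andP[xa wb].
have Q0 := quad_gt0 a b0 x w0; have bQ := quad_ge a b x w0.
have X2 : (x - a) ^+ 2 <= r0 ^+ 2 by rewrite -real_normK ?num_real // lerXn2r ?nnegrE // ltW.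
have r02 : r0 ^+ 2 <= r0 by rewrite expr2 -[leRHS]mulr1 ler_pM2l.
have X20 := sqr_ge0 (x - a).
move: wb; rewrite ler_norml => /andP[wb1 wb2].
have QQ : Q x w <= Qm by rewrite /quad /Qm; lra.
have om1 : 1 - om x w <= c * r0.
  rewrite one_sub_inv_cosh2 //; apply: (@le_trans _ _ ((4 + 4 * b ^+ 2) * r0 / (b ^+ 2) ^+ 2)).
    apply: ler_pM; rewrite ?invr_ge0 ?sqr_ge0 //.
    - by rewrite addr_ge0 ?sqr_ge0 // mulr_ge0 ?four_sqr_ge0 ?sqr_ge0.
    - have : ((x - a) ^+ 2 + w - b ^+ 2) ^+ 2 <= (2 * r0) ^+ 2.
        rewrite -[leLHS]real_normK ?num_real // lerXn2r ?nnegrE ?normr_ge0 //; first lra.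
        by rewrite ler_norml; lra.
      have : b ^+ 2 * (x - a) ^+ 2 <= b ^+ 2 * r0 by rewrite ler_pM2l //; lra.
      rewrite exprMn; lra.
    - by rewrite lef_pV2 ?posrE ?exprn_gt0 // lerXn2r ?nnegrE ?(ltW Q0) ?(ltW b20).
  by rewrite /c mulrAC.
have omJ : 1/2 <= om x w ^+ J0.
  apply: le_trans (bernoulli J0 _); last by rewrite inv_cosh2_ge0 ?inv_cosh2_le1.
  have : J0%:R * (1 - om x w) <= J0%:R * (c * r0) by rewrite ler_wpM2l.
  have : 0 <= r0 * c by rewrite mulr_ge0 // ltW.
  lra.
rewrite potentialE //.
have S : `|M| / Qm `^ (- lam) <= \sum_(j < J.+1) kappa lam j * om x w ^+ j.
  apply: (@le_trans _ _ (\sum_(j < J0) kappa lam j * om x w ^+ j)); last first.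
    have kge j : 0 <= kappa lam j * om x w ^+ j.
      by rewrite mulr_ge0 ?(ltW (kappa_gt0 _ _)) // exprn_ge0 ?inv_cosh2_ge0.
    rewrite -!(big_mkord xpredT (fun j => kappa lam j * om x w ^+ j)).
    by rewrite [leRHS](big_cat_nat (n := J0)) ?leqW //= lerDl sumr_ge0.
  apply: (@le_trans _ _ (\sum_(j < J0) kappa lam j * (1/2))).
    by rewrite -mulr_suml; lra.
  apply: ler_sum => j _; rewrite ler_wpM2l ?(ltW (kappa_gt0 _ _)) //.
  apply: le_trans omJ _; apply: ler_wiXn2l; rewrite ?inv_cosh2_ge0 ?inv_cosh2_le1 //; exact: ltnW.
have QN : Qm `^ (- lam) <= Q x w `^ (- lam) by rewrite powRN_le.
apply: le_trans (ler_norm M) _.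
rewrite -[`|M|](divfK (lt0r_neq0 Qm0)) mulrC; apply: ler_pM => //.
  exact: ltW.
by rewrite divr_ge0 // ltW.
Qed.
End PoleEstimates.

(** * Sign alternations of a combination of powers *)

Lemma near_all_seq (X : Type) (T : eqType) (F : set_system X) (FF : Filter F)
    (s : seq T) (P : T -> X -> Prop) :
  (forall t, t \in s -> \forall x \near F, P t x) ->
  \forall x \near F, forall t, t \in s -> P t x.
Proof.
elim: s => [|t s IH] h; first exact: filterE.
have ht := h t (mem_head _ _).
have hs : \forall x \near F, forall u, u \in s -> P u x.
  by apply: IH => u us; apply: h; rewrite inE us orbT.
by apply: filterS2 ht hs => x Pt Ps u; rewrite inE => /predU1P[->|/Ps].
Qed.

Lemma near_all_ord (X : Type) (m : nat) (F : set_system X) (FF : Filter F)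
    (P : 'I_m -> X -> Prop) :
  (forall k, \forall x \near F, P k x) -> \forall x \near F, forall k, P k x.
Proof.
move=> h; have := @near_all_seq X _ F FF (enum 'I_m) P (fun k _ => h k).
by apply: filterS => x Px k; apply: Px; rewrite mem_enum.
Qed.

Lemma near_zero_right (R : realType) (P : R -> Prop) :
  (exists2 d0, 0 < d0 & forall d, 0 < d <= d0 -> P d) -> \forall d \near 0^'+, P d.
Proof.
move=> [d0 d00 h]; near=> d; apply: h; apply/andP; split; near: d.
  exact: nbhs_right_gt.
exact: nbhs_right_le.
Unshelve. all: by end_near. Qed.

Lemma near_large (R : realType) (P : R -> Prop) :
  (exists d0, forall d, d0 <= d -> P d) -> \forall d \near +oo, P d.
Proof. by move=> [d0 h]; near=> d; apply: h; near: d; exact/nbhs_pinfty_ge/num_real.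
Unshelve. all: by end_near. Qed.

Lemma consistent_sum (R : realType) (lam : R) (I : Type) (s : seq I)
    (phi psi : I -> R -> R -> R) :
  (forall i, consistent lam (phi i) (psi i)) ->
  consistent lam (fun x w => \sum_(i <- s) phi i x w) (fun x w => \sum_(i <- s) psi i x w).
Proof.
move=> h; elim: s => [|i s IH].
  move=> rho; exists 0 => t x w _ _ _ _.
  by rewrite /discrete_op !big_nil !(mulr0, subr0, addr0, mul0r) normr0.
have := consistentD (h i) IH.
by congr consistent; do 2 (apply: funext => ?); rewrite big_cons.
Qed.

Section Alternation.
Variables (R : realType) (m : nat) (lam : R) (a b c : 'I_m -> R).
Hypotheses (lam_gt0 : 0 < lam) (b_gt0 : forall k, 0 < b k) (c_neq0 : forall k, c k != 0).
Hypothesis pole_inj : injective (fun k => (a k, b k)).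

Definition combination (x : R) := \sum_k c k * ((x - a k) ^+ 2 + b k ^+ 2) `^ (- lam).
Notation F := combination.
Definition superposition J (x w : R) := \sum_k c k * potential (a k) (b k) lam J x w.
Notation V := superposition.
Let c_sum := \sum_k `|c k|.

Lemma combination_continuous x : {for x, continuous F}.
Proof.
have dF k : is_derive x 1 (fun x => c k * ((x - a k) ^+ 2 + b k ^+ 2) `^ (- lam)) 
  (c k * (monomial_dx (a k) (b k) lam 1 0 0 0 x 0)).
  have := @is_derive_monomial_dx R (a k) (b k) lam (b_gt0 k) 0 0 0 0 x 0 (lexx 0).
  move=> /(is_deriveZ (c k)) h.
  have E : (fun x => c k * ((x - a k) ^+ 2 + b k ^+ 2) `^ (- lam)) =
     c k \*: (monomial_dx (a k) (b k) lam 0 0 0 0)^~ 0.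
    by apply: funext => y /=; rewrite /monomial /quad !expr0 !mul1r subr0 addr0.
  rewrite E; exact: h.
have := is_derive_continuous (is_derive_sum dF); rewrite fct_sumE.
exact.
Qed.

Lemma superposition_axis J x : V J x 0 = F x.
Proof. by apply: eq_bigr => k _; rewrite potential_axis. Qed.

Lemma superposition_consistent J : consistent lam (V J)
  (fun x w => - \sum_k c k * charge_density (a k) (b k) lam J x w).
Proof.
have := @consistent_sum _ lam _ (enum 'I_m) _ _ (fun k => consistentZ (c k)
  (potential_consistent (a k) (b_gt0 k) J lam_gt0)).
under [in X in consistent _ X _ -> _]eq_fun do under eq_fun do rewrite big_enum.
apply: consistent_eq => x w _.
by rewrite big_enum -sumrN; apply: eq_bigr => k _; rewrite mulrN.
Qed.

Lemma ler_norm_weighted_sum (u : 'I_m -> R) B : (forall k, `|u k| <= B) ->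
  `|\sum_k c k * u k| <= c_sum * B.
Proof.
move=> uB; apply: le_trans (ler_norm_sum _ _ _) _; rewrite mulr_suml.
by apply: ler_sum => k _; rewrite normrM ler_wpM2l.
Qed.

Lemma superposition_small_at_infinity eta : 0 < eta -> \forall rho \near +oo,
  forall J x w, 0 <= w -> rho <= `|x| \/ rho <= w -> `|V J x w| <= eta.
Proof.
move=> eta0; have c0 : 0 <= c_sum by apply: sumr_ge0.
have e0 : 0 < eta / (c_sum + 1) by rewrite divr_gt0 // ltr_wpDl.
have : \forall rho \near +oo, forall k J x w, 0 <= w -> rho <= `|x| \/ rho <= w ->
    potential (a k) (b k) lam J x w <= eta / (c_sum + 1).
  apply: near_all_ord => k; apply: near_large.
  have [rho0 h] := potential_small_at_infinity (a k) (b_gt0 k) lam_gt0 e0.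
  exists rho0 => d d0 J x w w0 dxw; apply: h => //.
  by case: dxw => ?; [left|right]; exact: le_trans d0 _.
apply: filterS => rho h J x w w0 xw.
apply: (@le_trans _ _ (c_sum * (eta / (c_sum + 1)))).
  by apply: ler_norm_weighted_sum => k; rewrite ger0_norm ?h // potential_ge0.
by rewrite mulrA ler_pdivrMr ?ltr_wpDl // mulrC ler_pM2l // lerDl.
Qed.

Lemma boxes_disjoint : \forall r \near 0^'+, forall k l, k != l ->
  forall x w, in_box (a k) (b k) r x w -> ~~ in_box (a l) (b l) r x w.
Proof.
apply: near_all_ord => k; apply: near_all_ord => l; apply: near_zero_right.
have [->|kl] := eqVneq k l; first by exists 1.
pose d := Num.max `|a k - a l| `|b k ^+ 2 - b l ^+ 2|.
have d0 : 0 < d.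
  rewrite lt_max !normr_gt0 !subr_eq0; apply/orP.
  have [akl|akl] := eqVneq (a k) (a l); [right|by left].
  apply: contra kl; rewrite eqrXn2 ?(ltW (b_gt0 _)) // => /eqP bkl.
  by apply/eqP/pole_inj; rewrite akl bkl.
exists (d / 3); first by rewrite divr_gt0.
move=> r /andP[r0 rd] _ x w /andP[xk wk]; apply/negP => /andP[xl wl].
have : d <= 2 * r.
  rewrite ge_max; apply/andP; split.
    have -> : a k - a l = x - a l - (x - a k) by ring.
    by apply: le_trans (ler_normB _ _) _; lra.
  have -> : b k ^+ 2 - b l ^+ 2 = w - b l ^+ 2 - (w - b k ^+ 2) by ring.
  by apply: le_trans (ler_normB _ _) _; lra.
lra.
Qed.

(* Near each pole its own potential dominates all the others. *)
Lemma superposition_sign_in_boxes rho : exists r J0, 0 < r /\ forall J, (J0 <= J)%N -> forall k x w,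
  `|x| <= rho -> 0 <= w <= rho -> in_box (a k) (b k) r x w -> 0 < c k * V J x w.
Proof.
have [r1 [dis r10]] : exists r1, (forall k l, k != l ->
  forall x w, in_box (a k) (b k) r1 x w -> ~~ in_box (a l) (b l) r1 x w) /\ 0 < r1.
  apply: (@filter_ex _ (0 : R)^'+); apply: filterI; first exact: boxes_disjoint.
  exact: nbhs_right_gt.
have /choice[B hB] : forall k, exists B, forall J x w, `|x| <= rho -> 0 <= w <= rho ->
    ~~ in_box (a k) (b k) r1 x w -> potential (a k) (b k) lam J x w <= B.
  by move=> k; apply: potential_bounded_off_box.
(* Inside the box of one pole this bounds the contribution of all the others, for every [J]. *)
pose Btot := \sum_k `|c k| * `|B k|.
have /choice[f hf] : forall k, exists rJ : R * nat, 0 < rJ.1 /\ forall J x w,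
    (rJ.2 <= J)%N -> 0 <= w -> in_box (a k) (b k) rJ.1 x w ->
    (Btot + 1) / `|c k| <= potential (a k) (b k) lam J x w.
  move=> k; have [r [J0 [r0 h]]] :=
    potential_large_in_box (a k) (b_gt0 k) lam_gt0 ((Btot + 1) / `|c k|).
  by exists (r, J0).
have near_f : \forall r \near (0 : R)^'+, forall k, r <= (f k).1.
  by apply: near_all_ord => k; apply: nbhs_right_le; case: (hf k).
have [r [rf [rr1 r0]]] := filter_ex (filterI near_f
  (filterI (nbhs_right_le r10) (nbhs_right_gt 0))).
have [J0 hJ0] : exists J0 : nat, forall k, ((f k).2 <= J0)%N.
  by exists (\max_k (f k).2) => k; exact: (@leq_bigmax_cond _ xpredT (fun k => (f k).2)).
exists r, J0; split => // J JJ k x w xr wr bx; case/andP: (wr) => w0 _.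
have sub_box (r' : R) l : r <= r' -> in_box (a l) (b l) r x w -> in_box (a l) (b l) r' x w.
  by move=> rr' /andP[h1 h2]; rewrite /in_box (le_trans h1) // (le_trans h2).
have pk : (Btot + 1) / `|c k| <= potential (a k) (b k) lam J x w.
  case: (hf k) => _; apply => //; first exact: leq_trans (hJ0 k) JJ.
  exact: sub_box bx.
have ck : 0 < `|c k| by rewrite normr_gt0.
rewrite /superposition (bigD1 k) //=; set S := \sum_(_ | _) _.
have SB : `|S| <= Btot.
  apply: le_trans (ler_norm_sum _ _ _) _.
  rewrite /Btot [leRHS](bigD1 k) //= ler_wpDl ?mulr_ge0 //; apply: ler_sum => l lk.
  rewrite normrM ler_wpM2l // ger0_norm ?potential_ge0 //.
  apply: le_trans (ler_norm _); apply: hB => //; apply: (dis k); first by rewrite eq_sym.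
  exact: sub_box bx.
rewrite mulrDr mulrA -expr2 -real_normK ?num_real //.
have h1 : `|c k| * (Btot + 1) <= `|c k| ^+ 2 * potential (a k) (b k) lam J x w.
  by rewrite expr2 -mulrA ler_pM2l // mulrC -ler_pdivrMr.
have h2 : `|c k * S| <= `|c k| * Btot by rewrite normrM ler_pM2l.
have := ler_norm (- (c k * S)); rewrite normrN; lra.
Qed.

Lemma charge_densities_small_off_boxes r rho eps : 0 < r -> 0 < eps ->
  exists J0, forall J, (J0 <= J)%N -> forall x w, `|x| <= rho -> 0 <= w <= rho -> (forall k, ~~ in_box (a k) (b k) r x w) ->
  `|\sum_k c k * charge_density (a k) (b k) lam J x w| <= eps.
Proof.
move=> r0 eps0; have c0 : 0 <= c_sum by apply: sumr_ge0.
have e0 : 0 < eps / (c_sum + 1) by rewrite divr_gt0 // ltr_wpDl.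
have /choice[f hf] : forall k, exists J0, forall J x w, (J0 <= J)%N -> `|x| <= rho ->
    0 <= w <= rho -> ~~ in_box (a k) (b k) r x w ->
    charge_density (a k) (b k) lam J x w <= eps / (c_sum + 1).
  by move=> k; apply: charge_density_small_off_box.
exists (\max_k f k) => J JJ x w xr wr nb; case/andP: (wr) => w0 _.
apply: (@le_trans _ _ (c_sum * (eps / (c_sum + 1)))).
  apply: ler_norm_weighted_sum => k; rewrite ger0_norm ?charge_density_ge0 //.
  by apply: hf => //; apply: leq_trans JJ; exact: (@leq_bigmax_cond _ xpredT f).
by rewrite mulrA ler_pdivrMr ?ltr_wpDl // mulrC ler_pM2l // lerDl.
Qed.
End Alternation.

Lemma convex_pred_ball (R : realType) (s h y r : R) : 0 <= h ->
  convex_pred (fun i => `|s + i%:R * h - y| <= r).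
Proof.
move=> h0 i j k; rewrite !ler_norml => /andP[i1 i2] /andP[k1 k2] /andP[ij jk].
have h1 : i%:R * h <= j%:R * h by rewrite ler_wpM2r // ler_nat.
have h2 : j%:R * h <= k%:R * h by rewrite ler_wpM2r // ler_nat.
apply/andP; split; lra.
Qed.

Lemma near_uniform_continuity (R : realType) (F : R -> R) (L : seq R) eta :
  0 < eta -> (forall x, {for x, continuous F}) ->
  \forall d \near 0^'+, forall t, t \in L -> forall x, `|x - t| <= d -> `|F x - F t| <= eta.
Proof.
move=> eta0 Fc; apply: near_all_seq => t _; apply: near_zero_right.
have /cvgrPdist_le/(_ _ eta0)/nbhs_ballP[e /= e0 he] := Fc t.
exists (e / 2) => [|d /andP[d0 de] x xt]; first by rewrite divr_gt0.
rewrite distrC; apply: he; rewrite /ball /= distrC; lra.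
Qed.

Lemma close_same_sign (R : realFieldType) (u v eta : R) : 0 < eta ->
  `|u - v| <= eta -> 2 * eta <= `|v| -> eta <= `|u| /\ (0 < u) = (0 < v).
Proof.
move=> eta0 uv; rewrite ler_normr => v2; split.
  by move: uv; rewrite ler_norml ler_normr => uv; apply/orP; case/orP: v2 => v2;
    [left|right]; lra.
by move: uv; rewrite ler_norml; case/orP: v2 => v2 uv; apply/idP/idP => ?; lra.
Qed.

Lemma fine_mesh (R : realType) (l d e C : R) : 0 < l -> 0 < d -> 0 < e ->
  exists n h, [/\ 0 < h, n%:R * h = l, h <= 1, h <= d & C * h <= e].
Proof.
(* The single condition [h * D <= 1] implies the three upper bounds on [h]. *)
move=> l0 d0 e0; pose D := 1 + d^-1 + `|C| / e.
have dV0 : 0 < d^-1 by rewrite invr_gt0.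
have Ce0 : 0 <= `|C| / e by rewrite divr_ge0 // ltW.
have D0 : 0 < D by rewrite /D; lra.
pose n := Num.bound (l * D).
have nD : l * D < n%:R by apply: archi_boundP; rewrite mulr_ge0 // ltW.
have n0 : 0 < n%:R :> R by apply: le_lt_trans nD; rewrite mulr_ge0 // ltW.
pose h := l / n%:R; have h0 : 0 < h by rewrite divr_gt0.
have hD : h * D <= 1 by rewrite /h mulrAC ler_pdivrMr // mul1r ltW.
have le1 t : 0 <= t <= D -> h * t <= 1.
  by case/andP=> _ tD; apply: le_trans hD; rewrite ler_pM2l.
exists n, h; split => //.
- by rewrite /h mulrC divfK // lt0r_neq0.
- by rewrite -[h]mulr1 le1 // ler01 /= /D; lra.
- have : h / d <= 1 by apply: le1; rewrite (ltW dV0) /= /D; lra.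
  by rewrite ler_pdivrMr // mul1r.
- have : h * (`|C| / e) <= 1 by apply: le1; rewrite Ce0 /= /D; lra.
  rewrite mulrA ler_pdivrMr // mul1r; apply: le_trans.
  by rewrite mulrC ler_wpM2l ?ler_norm // ltW.
Qed.

Lemma grid_op_discrete (R : realType) (lam h x0 : R) (V : R -> R -> R) (i j : nat) :
  (0 < i)%N ->
  grid_op (h ^+ 2)^-1 ((2 + 4 * lam) / h) (fun j => 4 * (j%:R * h) / h ^+ 2)
    (fun i j => V (x0 + i%:R * h) (j%:R * h)) i j =
  discrete_op lam h V (x0 + i%:R * h) (j%:R * h).
Proof.
move=> i0; rewrite /grid_op /discrete_op.
have -> : x0 + i.+1%:R * h = x0 + i%:R * h + h by rewrite -natr1; ring.
have -> : x0 + i.-1%:R * h = x0 + i%:R * h - h.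
  by rewrite -[in RHS](prednK i0) -natr1; ring.
have -> : j.+1%:R * h = j%:R * h + h by rewrite -natr1; ring.
case: j => [|j] /=; first by rewrite !mul0r !mulr0 !mul0r; ring.
have -> : j.+1%:R * h - h = j%:R * h by rewrite -natr1; ring.
by ring.
Qed.

(** The rectangle [[- rho, rho] x [0, 2 rho]] in the variables [(x, w)] is cut into [n] by [n] cells
    of side [h]. Points of [L] are moved to nearby nodes of the axis, where continuity preserves the
    signs and keeps the values above [eta]. *)
Theorem combination_alternation (R : realType) (m : nat) (lam : R) (a b c : 'I_m -> R)
    (L : seq R) :
  0 < lam -> (forall k, 0 < b k) -> (forall k, c k != 0) ->
  injective (fun k => (a k, b k)) ->
  let F := combination lam a b c in
  L != [::] -> sorted <%R L -> (forall t, t \in L -> F t != 0) ->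
  sorted (fun s t => (0 < F s) != (0 < F t)) L -> (size L < 2 * m)%N.
Proof.
move=> lam0 b0 c0 pinj F L0 Lsrt LF Lalt.
pose V := superposition lam a b c.
have near_eta : \forall eta \near 0^'+, forall t, t \in L -> 2 * eta <= `|F t|.
  apply: near_all_seq => t tL; apply: near_zero_right.
  exists (`|F t| / 2) => [|d]; last by lra.
  by rewrite divr_gt0 // normr_gt0 LF.
have [eta [heta eta0]] := filter_ex (filterI near_eta (nbhs_right_gt 0)).
have [d [hd d0]] := filter_ex (filterI
  (near_uniform_continuity L eta0 (@combination_continuous R m lam a b c b0)) (nbhs_right_gt 0)).
have near_rho : \forall rho \near +oo, forall t, t \in L -> `|t| + 1 <= rho.
  by apply: near_all_seq => t _; apply/nbhs_pinfty_ge/num_real.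
have eta4 : 0 < eta / 4 by rewrite divr_gt0.
have [rho [Vsmall [hrho rho1]]] := filter_ex (filterI
  (superposition_small_at_infinity a c lam0 b0 eta4)
  (filterI near_rho (nbhs_pinfty_ge (num_real 1)))).
have [r [J1 [r0 Vsg]]] := superposition_sign_in_boxes lam0 b0 c0 pinj (2 * rho).
(* Over the height [2 rho] the tilt amounts to [eta / 4]; with [|V| <= eta / 4] on the far sides,
   the sum stays below [eta]. *)
pose e := eta / (8 * rho).
have e0 : 0 < e by rewrite divr_gt0 //; lra.
have erho : e * rho = eta / 8 by rewrite /e; field; lra.
have [J2 hJ2] := charge_densities_small_off_boxes a c lam0 b0 (2 * rho) r0 e0.
pose J := maxn J1 J2.
have {}Vsg := Vsg J (leq_maxl _ _); have {}hJ2 := hJ2 J (leq_maxr _ _).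
have [C hC] := superposition_consistent a c lam0 b0 J (2 * rho).
have rho2 : 0 < 2 * rho by lra.
have e2 : 0 < e / 2 by lra.
(* Off the boxes the defect is at most [e] and the scheme error at most [e / 2], together less than
   [D * (e * h) = (2 + 4 * lam) * e]. *)
have [n [h [h0 hn h1 hd1 hCe]]] := fine_mesh C rho2 d0 e2.
pose X (i : nat) := - rho + i%:R * h.
have Xle (i : nat) : (i <= n)%N -> - rho <= X i <= rho.
  move=> i_n; have : i%:R * h <= n%:R * h by rewrite ler_wpM2r ?(ltW h0) // ler_nat.
  have : 0 <= i%:R * h by rewrite mulr_ge0 // ltW.
  rewrite /X; lra.
have Wle (j : nat) : (j <= n)%N -> 0 <= j%:R * h <= 2 * rho.
  move=> j_n; have : j%:R * h <= n%:R * h by rewrite ler_wpM2r ?(ltW h0) // ler_nat.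
  have : 0 <= j%:R * h by rewrite mulr_ge0 // ltW.
  lra.
have Xn (i : nat) : (i <= n)%N -> `|X i| <= 2 * rho.
  by move=> /Xle ?; rewrite ler_norml; lra.
pose v (i j : nat) := V J (X i) (j%:R * h).
pose px (k : 'I_m) (i : nat) := `|- rho + i%:R * h - a k| <= r.
pose py (k : 'I_m) (j : nat) := `|0 + j%:R * h - b k ^+ 2| <= r.
pose idx (t : R) := Num.truncn ((t + rho) / h).
have Xidx t : t \in L -> (idx t <= n)%N /\ `|X (idx t) - t| <= d.
  move=> tL; have tr := hrho t tL.
  have tr0 : 0 <= t + rho by have := ler_norm (- t); rewrite normrN; lra.
  have /andP[i1 i2] := truncn_itv (divr_ge0 tr0 (ltW h0)).
  rewrite ler_pdivlMr // in i1; rewrite ltr_pdivrMr // in i2.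
  split.
    rewrite -(ler_nat R) -(ler_pM2r h0) hn; apply: le_trans i1 _.
    by have := ler_norm t; lra.
  rewrite /X ler_norml; move: i1 i2; rewrite -/(idx t) -natr1; lra.
have Fidx t : t \in L -> [/\ F (X (idx t)) = v (idx t) 0%N,
    eta <= `|F (X (idx t))| & (0 < F (X (idx t))) = (0 < F t)].
  move=> tL; have [_ xt] := Xidx t tL.
  have h2 : `|F (X (idx t)) - F t| <= eta := hd t tL _ xt; have h3 := heta t tL.
  have [h4 h5] := close_same_sign eta0 h2 h3.
  by split => //; rewrite /v /V mul0r superposition_axis.
have vidx t : t \in L -> (0 < v (idx t) 0%N) = (0 < F t).
  by case/Fidx => <- _ ->.
pose B (j : nat) := 4 * (j%:R * h) / h ^+ 2.
have D0 : 0 < (2 + 4 * lam) / h by rewrite divr_gt0 //; lra.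
have eh0 : 0 < e * h by rewrite mulr_gt0.
have enE : e * h * n%:R = eta / 4 by rewrite -mulrA [h * _]mulrC hn; lra.
rewrite -(size_map idx).
apply: (@grid_alternation R n m (h ^+ 2)^-1 ((2 + 4 * lam) / h) (e * h) eta B v px py) => //.
- by rewrite invr_ge0 sqr_ge0.
- by move=> j; rewrite divr_ge0 ?sqr_ge0 // mulr_ge0 // mulr_ge0 // ltW.
- by rewrite /B mul0r mulr0 mul0r.
- by rewrite enE; lra.
- by move=> k; apply: convex_pred_ball; exact: ltW.
- by move=> k; apply: convex_pred_ball; exact: ltW.
- move=> k; have sg u : grid_box n px py k u -> 0 < c k * v u.1 u.2.
    case/and4P; rewrite /px /py add0r => px1 py1 u1 u2.
    by apply: Vsg; rewrite ?Xn ?Wle // /in_box -/(X _) px1 py1.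
  have := c0 k; rewrite neq_lt => /orP[ck|ck]; [right|left] => u /sg.
    by rewrite nmulr_rgt0.
  by rewrite pmulr_rgt0.
- move=> i j /andP[i0 i_n] j_n nbox.
  rewrite grid_op_discrete // -/(X i).
  have := hC h (X i) (j%:R * h); rewrite h0 h1 Xn ?(ltnW i_n) // Wle ?(ltnW j_n) //.
  have jh : j%:R * h = 0 \/ h <= j%:R * h.
    case: (j) => [|j']; [left|right]; first by rewrite mul0r.
    by rewrite -[leLHS]mul1r ler_wpM2r ?(ltW h0) // ler1n.
  move=> /(_ isT isT isT jh).
  have := hJ2 (X i) (j%:R * h); rewrite Xn ?(ltnW i_n) // Wle ?(ltnW j_n) //.
  have nb k : ~~ in_box (a k) (b k) r (X i) (j%:R * h).
    apply: contra (nbox k) => /andP[xk wk].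
    by apply/and4P; split; rewrite /px /py /= ?add0r ?(ltnW i_n) ?(ltnW j_n).
  move=> /(_ isT isT nb); set S := \sum_(_ < _) _; set dop := discrete_op _ _ _ _ _.
  rewrite opprK => S1 S2.
  have := ler_normB (dop + S) S; rewrite addrK.
  have -> : (2 + 4 * lam) / h * (e * h) = (2 + 4 * lam) * e by field; lra.
  have : 0 < lam * e by rewrite mulr_gt0.
  lra.
- move=> i j i_n j_n bnd; rewrite enE.
  suff : `|v i j| <= eta / 4 by lra.
  apply: Vsmall; first by case/andP: (Wle j j_n).
  case/orP: bnd => [/orP[]|] /eqP ->.
  + by left; rewrite /X mul0r addr0 normrN ler_norm.
  + by left; rewrite /X hn; apply: le_trans (ler_norm _); lra.
  + by right; rewrite hn; lra.
- by case: (L) L0.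
(* Rounding is only weakly monotone; neighbours of [L] get distinct nodes because the values there
   have different signs. *)
- rewrite sorted_map; have : sorted (fun s t => (s < t) && ((0 < F s) != (0 < F t))) L.
    by rewrite sorted_relI // Lsrt.
  apply: (sub_in_sorted (P := mem L)); last exact/allP.
  move=> s t sL tL /andP[st]; apply: contraTltn => ts /=.
  rewrite -(vidx s) // -(vidx t) //.
  have -> : idx s = idx t.
    apply/eqP; rewrite eqn_leq ts andbT; apply: le_truncn.
    by rewrite ler_pM2r ?invr_gt0 // lerD2r ltW.
  by rewrite eqxx.
- move=> i /mapP[t tL ->]; have [h2 _] := Xidx t tL; have [h3 h4 _] := Fidx t tL.
  by rewrite -h3.
- rewrite sorted_map; move: Lalt; apply: (sub_in_sorted (P := mem L)); last exact/allP.
  by move=> s t sL tL /=; rewrite !vidx.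
Qed.

(** Reduction to distinct poles with nonzero weights: terms with the same [(a, |b|)] are merged and
    those of total weight zero are dropped, which can only lower the bound. *)
Lemma sum_alternation (R : realType) (I : finType) (a b c : I -> R) (alpha : R)
    (L : seq R) :
  alpha < 0 -> (forall i, b i != 0) ->
  let F x := \sum_i c i * ((x - a i) ^+ 2 + b i ^+ 2) `^ alpha in
  L != [::] -> sorted <%R L -> (forall t, t \in L -> F t != 0) ->
  sorted (fun s t => (0 < F s) != (0 < F t)) L -> (size L < 2 * #|I|)%N.
Proof.
move=> al0 b0 F L0 Lsrt LF Lalt.
pose pole i := (a i, `|b i|).
pose cf p := \sum_(i | pole i == p) c i.
pose P := [seq p <- undup (map pole (enum I)) | cf p != 0].
have Puniq : uniq P by rewrite filter_uniq // undup_uniq.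
have PP p : p \in P -> 0 < p.2 /\ cf p != 0.
  rewrite mem_filter mem_undup => /andP[cp /mapP[i _ E]]; split => //.
  by rewrite E /= normr_gt0.
have sP : (size P <= #|I|)%N.
  rewrite size_filter (leq_trans (count_size _ _)) // (leq_trans (size_undup _)) //.
  by rewrite size_map -cardE.
pose T := in_tuple P.
pose a' k := (tnth T k).1; pose b' k := (tnth T k).2; pose c' k := cf (tnth T k).
have FE : F = combination (- alpha) a' b' c'.
  apply: funext => x; rewrite /combination opprK.
  pose G (p : R * R) := ((x - p.1) ^+ 2 + p.2 ^+ 2) `^ alpha.
  transitivity (\sum_(p <- P) cf p * G p); last by rewrite big_tnth.
  rewrite big_filter big_mkcond /=; set U := undup _.
  transitivity (\sum_(p <- U) \sum_(i | pole i == p) c i * G (pole i)); last first.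
    apply: eq_bigr => p _; transitivity (cf p * G p).
      by rewrite mulr_suml; apply: eq_bigr => i /eqP ->.
    by case: eqP => [->|//]; rewrite mul0r.
  rewrite (exchange_big_dep xpredT) //=; apply: eq_bigr => i _.
  transitivity (c i * G (pole i)).
    by rewrite /G /= real_normK ?num_real.
  rewrite -big_filter; under eq_filter do rewrite eq_sym.
  rewrite filter_pred1_uniq ?undup_uniq ?big_seq1 //.
  by rewrite mem_undup map_f // mem_enum.
have Tinj : injective (fun k => (a' k, b' k)).
  move=> k l; rewrite /a' /b' -!surjective_pairing => kl.
  apply/val_inj/eqP; rewrite -(nth_uniq (0, 0) (ltn_ord k) (ltn_ord l) Puniq).
  by apply/eqP; move: kl; rewrite !(tnth_nth (0, 0)).
apply: (@leq_trans (2 * size P)%N); last by rewrite leq_mul.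
apply: (@combination_alternation R _ (- alpha) a' b' c') => //; rewrite -?FE //.
- by rewrite oppr_gt0.
- by move=> k; case: (PP _ (mem_tnth k T)).
- by move=> k; case: (PP _ (mem_tnth k T)).
Qed.

(** * Identity theorem *)

(* [y j] plays the role of the Taylor coefficient [f^(j) / j!]. *)
Definition taylor_coefs (R : realType) (y : nat -> R -> R) :=
  forall j (x : R), is_derive x 1 (y j) (j.+1%:R * y j.+1 x).

Definition geometric_growth (R : realType) (y : nat -> R -> R) :=
  forall rho, exists C M, [/\ 0 <= C, 0 < M &
    forall j x, `|x| <= rho -> `|y j x| <= C * M ^+ j].

(** With [p] the primitive of the bound that vanishes at [x0], both [p + g] and [p - g] vanish at
    [x0] and have nonnegative derivatives on the interval. *)
Lemma derive_bound_integrate (R : realType) (g g' : R -> R) (x0 x A : R) N :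
  (forall t : R, is_derive t 1 g (g' t)) -> g x0 = 0 -> x0 <= x ->
  (forall t, x0 <= t <= x -> `|g' t| <= A * (t - x0) ^+ N) ->
  `|g x| <= A / N.+1%:R * (x - x0) ^+ N.+1.
Proof.
move=> dg g0 x0x bd; have N0 : N.+1%:R != 0 :> R by rewrite pnatr_eq0.
pose p t : R := A / N.+1%:R * (t - x0) ^+ N.+1.
have dp (t : R) : is_derive t 1 p (A * (t - x0) ^+ N).
  have dt : is_derive t 1 (fun t => t - x0) 1 by apply: is_derive_eq; rewrite subr0.
  apply: (is_derive_eq (is_deriveZ (A / N.+1%:R) (is_derive_exp N.+1 dt))).
  by rewrite /GRing.scale /=; field.
have p0 : p x0 = 0 by rewrite /p subrr expr0n mulr0.
rewrite ler_norml -/(p x); apply/andP; split.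
  have [c cx E] := @MVT_closed R (fun t => p t + g t) (fun t => A * (t - x0) ^+ N + g' t) x0 x x0x
    (fun t _ => is_deriveD (dp t) (dg t)).
  have : 0 <= (A * (c - x0) ^+ N + g' c) * (x - x0).
    apply: mulr_ge0; last by rewrite subr_ge0.
    by have := bd c cx; rewrite ler_norml; lra.
  by rewrite -E p0 g0; lra.
have [c cx E] := @MVT_closed R (fun t => p t - g t) (fun t => A * (t - x0) ^+ N - g' t) x0 x x0x
    (fun t _ => is_deriveB (dp t) (dg t)).
have : 0 <= (A * (c - x0) ^+ N - g' c) * (x - x0).
  apply: mulr_ge0; last by rewrite subr_ge0.
  by have := bd c cx; rewrite ler_norml; lra.
by rewrite -E p0 g0; lra.
Qed.

Lemma taylor_zero_right (R : realType) (y : nat -> R -> R) (x0 x C M : R) :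
  taylor_coefs y -> (forall j, y j x0 = 0) -> 0 < M -> 0 <= C ->
  x0 <= x -> 2 * M * (x - x0) <= 1 ->
  (forall j t, x0 <= t <= x -> `|y j t| <= C * M ^+ j) -> y 0%N x = 0.
Proof.
move=> dy y0 M0 C0 x0x xr bd.
(* Induction on [N] for all [j] at once: integrating the bound on the coefficient [j + 1] improves
   the one on [j] by a power of [t - x0]. At [j = 0] the binomial is [1] and the bound is at most
   [C / 2 ^ N]. *)
have taylor N j t : x0 <= t <= x ->
    `|y j t| <= C * M ^+ (j + N) * 'C(j + N, N)%:R * (t - x0) ^+ N.
  elim: N j t => [|N IH] j t tx; first by rewrite addn0 bin0 expr0 !mulr1; exact: bd.
  have := @derive_bound_integrate R (y j) (fun t => j.+1%:R * y j.+1 t) x0 t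
    (j.+1%:R * (C * M ^+ (j.+1 + N) * 'C(j.+1 + N, N)%:R)) N (dy j) (y0 j).
  move=> /(_ ltac:(lra)) h; apply: le_trans (h _) _ => [s sx|].
    by rewrite normrM ger0_norm // -mulrA ler_wpM2l // IH //; lra.
  apply: ler_wpM2r; first by rewrite exprn_ge0 //; lra.
  rewrite ler_pdivrMr ?ltr0n // addSnnS mulrCA -!mulrA ler_wpM2l //.
  rewrite ler_wpM2l ?exprn_ge0 ?(ltW M0) //.
  rewrite -!natrM ler_nat addnS mulnC [leqRHS]mulnC.
  by rewrite [leqRHS]mul_bin_left mulnC -addSn addnK.
have h01 : 0 <= M * (x - x0) <= 1/2.
  have : 0 <= M * (x - x0) by rewrite mulr_ge0 ?(ltW M0) //; lra.
  by move=> h; apply/andP; split; lra.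
apply/eqP; rewrite -normr_le0; apply/ler_addgt0Pr => eps eps0; rewrite add0r.
have [||N hN] := @expr_eventually_le R (1/2) (eps / (C + 1)); first lra.
  by rewrite divr_gt0 // ltr_wpDl.
have := taylor N 0%N x; rewrite add0n binn mulr1 lexx x0x => /(_ isT) h.
apply: le_trans h _; rewrite -mulrA -exprMn.
have : (M * (x - x0)) ^+ N <= (1/2) ^+ N by rewrite lerXn2r ?nnegrE //; lra.
have := hN N (leqnn _); rewrite ler_pdivlMr ?ltr_wpDl // => h1 h2.
apply: le_trans (ler_wpM2l C0 h2) _.
have : 0 <= (1/2 : R) ^+ N by rewrite exprn_ge0 //; lra.
lra.
Qed.

Lemma taylor_coefs_zero (R : realType) (y : nat -> R -> R) (p q : R) :
  taylor_coefs y -> (forall x, p < x < q -> y 0%N x = 0) ->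
  forall j x, p < x < q -> y j x = 0.
Proof.
move=> dy y0; elim=> [//|j IH] x pxq.
have xpq : x \in `]p, q[%R by rewrite in_itv /= pxq.
have nz : \forall z \near x, cst 0 z = y j z.
  by apply: filterS (near_in_itvoo xpq) => z; rewrite in_itv /= => /IH ->.
have d0 : is_derive x 1 (y j) 0.
  exact: near_eq_is_derive nz (is_derive_cst _ _ _).
have := @derive_val _ _ _ _ _ _ _ (dy j x); rewrite (@derive_val _ _ _ _ _ _ _ d0).
by move/esym/eqP; rewrite mulf_eq0 pnatr_eq0 /= => /eqP.
Qed.

(** The growth constants are uniform on a compact interval containing [x1], so the zero interval can
    be extended by the same length [r] at each step and reaches [x1] after finitely many. *)
Lemma identity_theorem_right (R : realType) (y : nat -> R -> R) (p q : R) :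
  taylor_coefs y -> geometric_growth y -> p < q ->
  (forall x, p < x < q -> y 0%N x = 0) -> forall x, p < x -> y 0%N x = 0.
Proof.
move=> dy gy pq y0 x1 px1; pose rho := `|p| + `|x1| + 1.
have [C [M [C0 M0 bd]]] := gy rho.
pose r := (2 * M)^-1; have r0 : 0 < r by rewrite invr_gt0 mulr_gt0.
have ext N x : p < x < q + N%:R * r -> x < x1 + 1 -> y 0%N x = 0.
  elim: N x => [|N IH] x pxN xx1; first by apply: y0; lra.
  have [xN|xN] := ltP x (q + N%:R * r); first by apply: IH => //; lra.
  have Nr : 0 <= N%:R * r by rewrite mulr_ge0 // ltW.
  (* An expansion point within [r] of [x] that is still interior to the known zero interval; the
     midpoint keeps it to the right of [p]. *)
  pose x0 := Num.max (x - r) ((p + q) / 2).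
  have x0l : x - r <= x0 by rewrite le_max lexx.
  have x0l' : (p + q) / 2 <= x0 by rewrite le_max lexx orbT.
  have x0x : x0 < x by rewrite gt_max; apply/andP; split; lra.
  have x0q : x0 < q + N%:R * r.
    by rewrite -natr1 mulrDl in pxN; rewrite gt_max; apply/andP; split; lra.
  have y0' z : p < z < Num.min (q + N%:R * r) (x1 + 1) -> y 0%N z = 0.
    by rewrite lt_min => /and3P[pz zq zx1]; apply: IH => //; rewrite pz.
  have z0 j : y j x0 = 0.
    apply: (taylor_coefs_zero dy y0'); rewrite lt_min x0q; apply/and3P; split => //; lra.
  apply: (taylor_zero_right dy z0 M0 C0 (ltW x0x)).
    by rewrite -ler_pdivlMl ?mulr_gt0 // mulr1 -/r; lra.
  move=> j t tx; apply: bd; rewrite ler_norml /rho.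
  have := ler_norm (- p); have := ler_norm x1; rewrite normrN.
  have := normr_ge0 x1; have := normr_ge0 p; lra.
apply: (ext (Num.bound ((x1 - q) / r)) x1); last by rewrite ltrDl.
rewrite px1 /=; have [xq|qx] := ltP x1 q.
  by rewrite ltr_wpDr // mulr_ge0 // ltW.
have := archi_boundP (divr_ge0 (_ : 0 <= x1 - q) (ltW r0)).
by rewrite subr_ge0 => /(_ qx); rewrite ltr_pdivrMr //; lra.
Qed.

Lemma identity_theorem (R : realType) (y : nat -> R -> R) (p q : R) :
  taylor_coefs y -> geometric_growth y -> p < q ->
  (forall x, p < x < q -> y 0%N x = 0) -> forall x, y 0%N x = 0.
Proof.
move=> dy gy pq y0 x; have [px|xp] := ltP p x; first exact: (identity_theorem_right dy gy pq y0).
pose z j x := (-1) ^+ j * y j (- x).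
have dz : taylor_coefs z.
  move=> j t; have dN : is_derive t 1 (fun t : R => - t) (-1) by apply: is_derive_eq.
  have := is_deriveZ ((-1) ^+ j) (@is_derive1_comp R (y j) _ t _ _ (dy j (- t)) dN).
  move=> h; apply: (is_derive_eq h).
  by rewrite /z exprS /GRing.scale /=; ring.
have gz : geometric_growth z.
  move=> rho; have [C [M [C0 M0 bd]]] := gy rho; exists C, M; split => // j t tr.
  by rewrite /z normrMsign bd // normrN.
have : z 0%N (- x) = 0.
  apply: (@identity_theorem_right R z (- q) (- p) dz gz); try lra.
  by move=> t tpq; rewrite /z expr0 mul1r; apply: y0; lra.
by rewrite /z expr0 mul1r opprK.
Qed.

Section PowCoefs.
Variables (R : realType) (a b al : R).
Let q (x : R) := (x - a) ^+ 2 + b ^+ 2.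

(* The Leibniz rule applied to [q y' = al q' y] gives the recurrence
   [(j + 1) q u_(j+1) = (al - j) q' u_j + (2 al - j + 1) u_(j-1)]
   for [u_j = y^(j) / j!]; the pair is [(u_(j-1), u_j)]. *)
Fixpoint pow_coefs (j : nat) (x : R) : R * R :=
  if j is j'.+1 then
    let u := pow_coefs j' x in
    (u.2, ((al - j'%:R) * (2 * (x - a)) * u.2 + (2 * al - j'%:R + 1) * u.1)
          / (j'.+1%:R * q x))
  else (0, q x `^ al).

Definition pow_coef j x := (pow_coefs j x).2.

Lemma pow_coef_base_gt0 (b0 : b != 0) x : 0 < q x.
Proof. by rewrite /q ltr_wpDl ?sqr_ge0 // exprn_even_gt0. Qed.

Lemma is_derive_pow_coefs (b0 : b != 0) j (x : R) :
  is_derive x 1 (fun x => (pow_coefs j x).1) (j%:R * pow_coef j x) /\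
  is_derive x 1 (pow_coef j) (j.+1%:R * pow_coef j.+1 x).
Proof.
have q0 := pow_coef_base_gt0 b0.
have dx : is_derive x 1 (fun x => x - a) 1 by apply: is_derive_eq; rewrite subr0.
have dq : is_derive x 1 q (2 * (x - a)).
  by apply: is_derive_eq; rewrite ?subr0 /GRing.scale /=; ring.
elim: j => [|j [IH1 IH2]].
  split; first by rewrite mul0r; exact: is_derive_cst.
  have := @is_derive1_comp R (fun y => y `^ al) q x _ _ (is_derive1_powR _ (q0 x)) dq.
  move=> h; apply: (is_derive_eq h); rewrite /pow_coef /=.
  have -> : q x `^ al = q x `^ (al - 1) * q x.
    by rewrite -[X in _ * X](powRr1 (ltW (q0 x))) -powRD ?subrK // (gt_eqF (q0 x)) implybT.
  by field; rewrite gt_eqF.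
split; first by [].
have j0 : j.+1%:R != 0 :> R by rewrite pnatr_eq0.
pose N (x : R) := 2 * (al - j%:R) * (x - a) * pow_coef j x
                  + (2 * al - j%:R + 1) * (pow_coefs j x).1.
have dN : is_derive x 1 N (2 * (al - j%:R) * (pow_coef j x + (x - a) * (j.+1%:R * pow_coef j.+1 x))
                           + (2 * al - j%:R + 1) * (j%:R * pow_coef j x)).
  apply: (is_derive_eq (is_deriveD
    (is_deriveM (is_deriveZ (2 * (al - j%:R)) dx) IH2)
    (is_deriveZ (2 * al - j%:R + 1) IH1))).
  by rewrite /GRing.scale /= /GRing.scale /=; ring.
have dV : is_derive x 1 (fun x => (j.+1%:R * q x)^-1)
    (- (j.+1%:R * q x) ^- 2 * (j.+1%:R * (2 * (x - a)))).
  have qn : j.+1%:R * q x != 0 by rewrite mulf_neq0 // gt_eqF.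
  exact: (@is_deriveV R (fun x => j.+1%:R * q x) x _ 1 qn (is_deriveZ j.+1%:R dq)).
have NE y : pow_coef j.+1 y = N y / (j.+1%:R * q y).
  by rewrite /pow_coef /= /N -/(pow_coef j y); congr (_ / _); ring.
have -> : pow_coef j.+1 = (fun y => N y * (j.+1%:R * q y)^-1) by apply: funext.
apply: (is_derive_eq (is_deriveM dN dV)).
have -> : pow_coef j.+2 x = ((al - j.+1%:R) * (2 * (x - a)) * pow_coef j.+1 x +
    (2 * al - j.+1%:R + 1) * pow_coef j x) / (j.+2%:R * q x) by [].
rewrite NE /GRing.scale /= -[j.+2%:R]natr1 /N.
move: (pow_coef j x) (pow_coefs j x).1 (q0 x) j0 => u u' qx.
rewrite -[j.+1%:R]natr1 /q => j1.
move: (j%:R : R) j1 (ler0n R j) => t t1 t0; field.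
by rewrite -/(q x) (gt_eqF qx) t1 /= gt_eqF //; lra.
Qed.

(** In the recurrence both numerator coefficients are [O(j + 1)] on a bounded set, and the
    denominator is at least [(j + 1) b ^ 2], so each step multiplies the bound by at most a
    constant. The bound covers both entries of the pair because the recurrence has order two. *)
Lemma pow_coef_growth (b0 : b != 0) rho : exists C M, [/\ 0 <= C, 1 <= M &
  forall j x, `|x| <= rho -> `|(pow_coefs j x).1| <= C * M ^+ j /\ `|pow_coef j x| <= C * M ^+ j].
Proof.
have nb0 : 0 < `|b| by rewrite normr_gt0.
have [C hC] := @monomial_bounded R a `|b| al nb0 0 0 0 `|rho|.
have r0 := normr_ge0 rho; have al0 := normr_ge0 al; have a0 := normr_ge0 a.
have C0 : 0 <= C by apply: le_trans (hC 0 0 _ _); rewrite ?normr_ge0 ?normr0 // lexx.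
have b20 : 0 < b ^+ 2 by rewrite exprn_even_gt0.
pose A := 2 * (`|rho| + `|a|).
have A0 : 0 <= A by rewrite /A; lra.
pose D := (`|al| + 1) * A + (2 * `|al| + 1).
have D0 : 0 <= D by rewrite /D addr_ge0 ?mulr_ge0 //; lra.
exists C, (1 + D / b ^+ 2); split => //.
  by rewrite lerDl divr_ge0 // ltW.
set M := 1 + _; have M1 : 1 <= M by rewrite lerDl divr_ge0 // ltW.
move=> j x xr; have {}xr : `|x| <= `|rho| by apply: le_trans xr (ler_norm _).
elim: j => [|j [IH1 IH2]].
  rewrite /pow_coef /= normr0 expr0 mulr1; split => //.
  have := hC x 0 xr; rewrite lexx r0 => /(_ isT).
  by rewrite /monomial /quad !expr0 !mul1r subr0 addr0 real_normK ?num_real.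
have K0 : 0 <= C * M ^+ j by rewrite mulr_ge0 // exprn_ge0 //; lra.
have KS : C * M ^+ j.+1 = C * M ^+ j * M by rewrite exprSr mulrA.
split; first by rewrite /= -/(pow_coef j x) KS; apply: le_trans IH2 _; rewrite ler_peMr.
have t0 : 0 <= j%:R :> R by [].
have q0 := pow_coef_base_gt0 b0 x.
have bq : b ^+ 2 <= q x by rewrite lerDr sqr_ge0.
rewrite /pow_coef /= -/(pow_coef j x) KS normrM normfV [X in _ / X]ger0_norm; last first.
  by rewrite mulr_ge0 // ltW.
rewrite ler_pdivrMr ?mulr_gt0 ?ltr0n //.
have xa : `|2 * (x - a)| <= A.
  rewrite normrM ger0_norm // /A ler_pM2l //.
  by apply: le_trans (ler_normB _ _) _; rewrite lerD2r.
apply: (@le_trans _ _ (C * M ^+ j * (j.+1%:R * D))); last first.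
  rewrite -[leRHS]mulrA ler_wpM2l // [leRHS]mulrCA ler_wpM2l //.
  have : D / b ^+ 2 * b ^+ 2 <= M * q x.
    apply: ler_pM => //; last by rewrite lerDr.
      by rewrite divr_ge0 // ltW.
    exact: ltW.
  by rewrite divfK ?gt_eqF.
apply: le_trans (ler_normD _ _) _; rewrite !normrM -normrM.
have h1 : `|al - j%:R| <= j.+1%:R * (`|al| + 1).
  apply: le_trans (ler_normB _ _) _; rewrite [`|j%:R|]ger0_norm // -natr1.
  by have := mulr_ge0 t0 al0; lra.
have h2 : `|2 * al - j%:R + 1| <= j.+1%:R * (2 * `|al| + 1).
  apply: le_trans (ler_normD _ _) _; rewrite normr1.
  have := ler_normB (2 * al) j%:R; rewrite normrM [`|2|]ger0_norm // [`|j%:R|]ger0_norm // -natr1.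
  by have := mulr_ge0 t0 al0; lra.
have h3 : `|al - j%:R| * `|2 * (x - a)| * `|pow_coef j x|
    <= j.+1%:R * (`|al| + 1) * A * (C * M ^+ j).
  by apply: ler_pM => //; exact: ler_pM.
have h4 : `|2 * al - j%:R + 1| * `|(pow_coefs j x).1| <= j.+1%:R * (2 * `|al| + 1) * (C * M ^+ j).
  exact: ler_pM.
rewrite /D; lra.
Qed.
End PowCoefs.

(** * Critical points *)

Section PowerSum.
Variables (R : realType) (n : nat) (a b c : 'I_n -> R) (al : R).
Notation F := (quadratic_power_sum a b c al).

Definition power_sum_coef j (x : R) := \sum_k c k * pow_coef (a k) (b k) al j x.

Lemma power_sum_coef0 : power_sum_coef 0 = F.
Proof. by []. Qed.

Lemma is_derive_power_sum_coef (b0 : forall k, b k != 0) j (x : R) :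
  is_derive x 1 (power_sum_coef j) (j.+1%:R * power_sum_coef j.+1 x).
Proof.
have d k := is_deriveZ (c k) (is_derive_pow_coefs (a k) al (b0 k) j x).2.
have := is_derive_sum d; rewrite fct_sumE => h; apply: (is_derive_eq h).
by rewrite mulr_sumr; apply: eq_bigr => k _; rewrite /GRing.scale /= mulrCA.
Qed.

Lemma power_sum_vanishes_at_infinity (b0 : forall k, b k != 0) (al0 : al < 0) eps :
  0 < eps -> exists x, `|F x| <= eps.
Proof.
move=> eps0; have nb k : 0 < `|b k| by rewrite normr_gt0.
have lam0 : 0 < - al by rewrite oppr_gt0.
have [rho [h rho0]] := filter_ex (filterI
  (superposition_small_at_infinity a c lam0 nb eps0) (nbhs_pinfty_ge (num_real 0))).
(* On the axis every truncation equals the sum of powers itself, so [J = 0] will do. *)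
exists rho; have := h 0%N rho 0 (lexx 0) (or_introl (ler_norm rho)).
rewrite superposition_axis /combination opprK; congr (`|_| <= _); apply: eq_bigr => k _.
by rewrite real_normK ?num_real.
Qed.

(** Subtracting [K] affects only the Taylor coefficient of index [0], so the identity theorem makes
    [F] equal to [K] everywhere; decay at infinity then forces [K = 0]. *)
Lemma power_sum_constant_eq0 (b0 : forall k, b k != 0) (al0 : al < 0) (p q K : R) :
  p < q -> (forall x, p < x < q -> F x = K) -> forall x, F x = 0.
Proof.
move=> pq FK; pose y j (x : R) := power_sum_coef j x - (if j is 0%N then K else 0).
have dy : taylor_coefs y.
  move=> j x; have dc := is_derive_power_sum_coef b0 j x.
  apply: (is_derive_eq (is_deriveB dc (is_derive_cst _ _ _))).
  by rewrite /y !subr0.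
have gy : geometric_growth y.
  move=> rho; have /choice[f hf] : forall k, exists CM : R * R, [/\ 0 <= CM.1, 1 <= CM.2 &
      forall j x, `|x| <= rho -> `|pow_coef (a k) (b k) al j x| <= CM.1 * CM.2 ^+ j].
    move=> k; have [C [M [C0 M1 h]]] := pow_coef_growth (a k) al (b0 k) rho.
    by exists (C, M); split => // j x /(h j)[].
  pose M := 1 + \sum_k (f k).2; pose C := `|K| + \sum_k `|c k| * (f k).1.
  have f2 k : 0 <= (f k).2 by case: (hf k) => _ /(le_trans ler01).
  have f1 k : 0 <= (f k).1 by case: (hf k).
  have M1 : 1 <= M by rewrite lerDl sumr_ge0.
  have fM k : (f k).2 <= M.
    by rewrite /M (bigD1 k) //= addrCA lerDl addr_ge0 // sumr_ge0.
  exists C, M; split.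
  - by rewrite addr_ge0 // sumr_ge0 // => k _; rewrite mulr_ge0.
  - lra.
  - move=> j x xr; rewrite /y /C [in leRHS]addrC [in leRHS]mulrDl.
    apply: le_trans (ler_normB _ _) _; rewrite lerD //; last first.
      by case: j => [|j]; rewrite ?expr0 ?mulr1 // normr0 mulr_ge0 // exprn_ge0 //; lra.
    apply: le_trans (ler_norm_sum _ _ _) _; rewrite mulr_suml; apply: ler_sum => k _.
    rewrite normrM -mulrA ler_wpM2l //; case: (hf k) => _ _ /(_ j x xr) /le_trans; apply.
    by rewrite ler_wpM2l // lerXn2r ?nnegrE //; lra.
have FE x : F x = K.
  have := @identity_theorem R y p q dy gy pq; rewrite /y power_sum_coef0 => h.
  by apply/eqP; rewrite -subr_eq0; apply/eqP/h => t /FK ->; rewrite subrr.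
move=> x; rewrite FE; apply/eqP; rewrite -normr_le0; apply/ler_addgt0Pr => eps eps0.
by have [t] := power_sum_vanishes_at_infinity b0 al0 eps0; rewrite FE add0r.
Qed.

Lemma power_sum_derivative_nonzero (b0 : forall k, b k != 0) (al0 : al < 0) (p q : R) :
  ~ (forall x, F x = 0) -> p < q -> exists2 x, p < x < q & power_sum_coef 1 x != 0.
Proof.
move=> F0 pq; apply: contrapT => no; apply: F0.
have g0 x : p < x < q -> power_sum_coef 1 x = 0.
  by move=> pxq; apply/eqP; apply: contraPT no => gx; apply; exists x.
apply: (@power_sum_constant_eq0 b0 al0 p q (F ((p + q) / 2)) pq) => x pxq.
have dF (t : R) := is_derive_power_sum_coef b0 0 t.
have cst s t : p < s -> s <= t -> t < q -> F s = F t.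
  move=> ps st tq; have [c' c'st E] := MVT_closed st (fun t _ => dF t).
  by apply/esym/eqP; rewrite -subr_eq0 -power_sum_coef0 E g0 ?mulr0 ?mul0r //; lra.
by have [xm|/ltW xm] := leP x ((p + q) / 2); [|symmetry]; apply: cst; lra.
Qed.

(* The derivative is a limit of difference quotients, which are combinations of
   [2 n] powers. *)
Lemma perturbed_derivative_alternation (b0 : forall k, b k != 0) (al0 : al < 0)
    (k0 : 'I_n) (eps : R) (L : seq R) :
  let G x := power_sum_coef 1 x + eps * ((x - a k0) ^+ 2 + b k0 ^+ 2) `^ al in
  L != [::] -> sorted <%R L -> (forall x, x \in L -> G x != 0) ->
  sorted (fun x y => (0 < G x) != (0 < G y)) L -> (size L < 4 * n)%N.
Proof.
move=> G L0 Lsrt LG Lalt.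
have near_eta : \forall eta \near 0^'+, forall t, t \in L -> 2 * eta <= `|G t|.
  apply: near_all_seq => t tL; apply: near_zero_right.
  exists (`|G t| / 2) => [|d]; last by lra.
  by rewrite divr_gt0 // normr_gt0 LG.
have [eta [heta eta0]] := filter_ex (filterI near_eta (nbhs_right_gt 0)).
have [d [hd d0]] := filter_ex (filterI
  (near_uniform_continuity L eta0 (fun x => is_derive_continuous (is_derive_power_sum_coef b0 1 x)))
  (nbhs_right_gt 0)).
(* The left summand carries [F (x + d) / d], whose poles are shifted by [- d]; the right one carries
   [- F x / d], and its term [k0] also absorbs the perturbation, so the count stays at [2 n]. *)
pose a' (i : 'I_n + 'I_n) := match i with inl k => a k - d | inr k => a k end.
pose b' (i : 'I_n + 'I_n) := match i with inl k => b k | inr k => b k end.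
pose c' (i : 'I_n + 'I_n) := match i with
  inl k => c k / d | inr k => - (c k / d) + eps * (k == k0)%:R end.
pose H x := \sum_i c' i * ((x - a' i) ^+ 2 + b' i ^+ 2) `^ al.
have HE x : H x = (F (x + d) - F x) / d + eps * ((x - a k0) ^+ 2 + b k0 ^+ 2) `^ al.
  rewrite /H big_sumType /= mulrBl /quadratic_power_sum !mulr_suml -addrA; congr (_ + _).
    by apply: eq_bigr => k _; rewrite opprB addrA mulrAC addrAC.
  transitivity (- (\sum_k c k * ((x - a k) ^+ 2 + b k ^+ 2) `^ al / d) +
     \sum_k (if k == k0 then eps * ((x - a k) ^+ 2 + b k ^+ 2) `^ al else 0)).
    rewrite -sumrN -big_split /=; apply: eq_bigr => k _.
    by case: eqP => _ /=; ring.
  by rewrite -big_mkcond big_pred1_eq.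
have HG x : x \in L -> `|H x - G x| <= eta.
  move=> xL; rewrite HE /G opprD addrACA subrr addr0.
  have xd : x <= x + d by rewrite lerDl ltW.
  have [t tx] := MVT_closed xd (fun t _ => is_derive_power_sum_coef b0 0 t).
  rewrite power_sum_coef0 => ->; rewrite mul1r addrAC subrr add0r mulfK ?gt_eqF //.
  by apply: hd => //; rewrite ger0_norm; lra.
have sgn x : x \in L -> H x != 0 /\ (0 < H x) = (0 < G x).
  move=> xL; have [Hx ->] := close_same_sign eta0 (HG x xL) (heta x xL).
  by split => //; rewrite -normr_gt0; apply: lt_le_trans eta0 Hx.
have -> : (4 * n = 2 * #|{: 'I_n + 'I_n}|)%N by rewrite card_sum card_ord; lia.
apply: (@sum_alternation R _ a' b' c' al) => //.
- by case=> k; exact: b0.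
- by move=> x xL; case: (sgn x xL).
- move: Lalt; apply: (sub_in_sorted (P := mem L)); last exact/allP.
  by move=> x y xL yL; rewrite -/(H x) -/(H y) (sgn x xL).2 (sgn y yL).2.
Qed.
End PowerSum.

(* Between two consecutive zeros [t] with equal signs of [g] on both sides, exactly
   one of the two conventions for the sign of [g t] creates two sign changes. *)
Lemma alternation_of_zeros (R : realType) (g : R -> R) (s0 : R) (ts : seq R) :
  (forall p q, p < q -> exists2 x, p < x < q & g x != 0) ->
  path <%R s0 ts -> g s0 != 0 -> (forall t, t \in ts -> g t = 0) ->
  exists L1 L2, [/\ path (fun x y => (x < y) && ((0 < g x) != (0 < g y))) s0 L1,
    path (fun x y => (x < y) && ((0 <= g x) != (0 <= g y))) s0 L2 &
    (size L1 + size L2 = 2 * size ts)%N].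
Proof.
move=> dense; elim: ts s0 => [|t ts IH] s0; first by exists [::], [::].
move=> /= /andP[s0t tsP] gs0 gts.
have gt0 : g t = 0 by apply: gts; rewrite mem_head.
(* A sample point after [t] and before the next listed zero, where [g] does not vanish; it takes
   over the role of [s0]. *)
have [s1 ts1 [s1P gs1]] : exists2 s1, t < s1 & path <%R s1 ts /\ g s1 != 0.
  case: ts tsP {IH gts} => [|t' ts] /= tsP.
    by have [x /andP[tx _] gx] := dense t (t + 1) ltac:(by rewrite ltrDl); exists x.
  case/andP: tsP => tt' ->; have [x /andP[tx xt'] gx] := dense t t' tt'.
  by exists x; rewrite ?xt'.
have [|L1 [L2 [P1 P2 sz]]] := IH s1 s1P gs1.
  by move=> u uts; apply: gts; rewrite inE uts orbT.
have s01 := lt_trans s0t ts1.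
have chg (r : rel R) L : path r s1 L -> (forall y, r s1 y -> r s0 y) -> path r s0 L.
  by case: L => //= y L /andP[h ->] /(_ y h) ->.
have [p0|n0] := ltP 0 (g s0); have [p1|n1] := ltP 0 (g s1).
- exists [:: t, s1 & L1], L2; split => /=.
  + by rewrite s0t ts1 P1 gt0 p0 p1 ltxx.
  + by apply: chg P2 _ => y /=; rewrite (ltW p0) (ltW p1) => /andP[/(lt_trans s01)->].
  + by rewrite mulnS -sz ?addSn ?addnS.
- exists (s1 :: L1), (s1 :: L2); split => /=.
  + by rewrite s01 P1 p0 ltNge n1.
  + by rewrite s01 P2 (ltW p0) leNgt lt_neqAle gs1 n1.
  + by rewrite mulnS -sz ?addSn ?addnS.
- exists (s1 :: L1), (s1 :: L2); split => /=.
  + by rewrite s01 P1 p1 ltNge n0.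
  + by rewrite s01 P2 (ltW p1) leNgt lt_neqAle gs0 n0.
  + by rewrite mulnS -sz ?addSn ?addnS.
- exists L1, [:: t, s1 & L2]; split => /=.
  + apply: chg P1 _ => y /=; rewrite ![0 < g s0]ltNge ![0 < g s1]ltNge n0 n1.
    by case/andP=> /(lt_trans s01)->.
  + by rewrite s0t ts1 P2 gt0 lexx ![0 <= g s0]leNgt ![0 <= g s1]leNgt !lt_neqAle gs0 gs1 n0 n1.
  + by rewrite mulnS -sz ?addSn ?addnS.
Qed.

Lemma not_card_le_seq (T : choiceType) (S : set T) N :
  ~ (S #<= `I_N)%card -> exists s : seq T, [/\ uniq s, size s = N.+1 & forall x, x \in s -> S x].
Proof.
move=> SN; apply: contrapT => no; apply: SN.
have bd (s : seq T) : uniq s -> (forall x, x \in s -> S x) -> (size s <= N)%N.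
  move=> us sS; rewrite leqNgt; apply/negP => Ns; apply: no.
  exists (take N.+1 s); split; first exact: take_uniq.
    by rewrite size_takel.
  by move=> x /mem_take /sS.
pose P k := `[< exists s : seq T, [/\ uniq s, size s = k & forall x, x \in s -> S x] >].
have P0 : exists k, P k by exists 0%N; apply/asboolP; exists [::].
have PN k : P k -> (k <= N)%N by move=> /asboolP[s [us <- sS]]; exact: bd.
case: (ex_maxnP P0 PN) => k /asboolP[s [us sk sS]] kmax.
have sub x : S x -> x \in s.
  move=> Sx; apply: contraT => xs.
  suff /kmax : P k.+1 by rewrite ltnn.
  apply/asboolP; exists (x :: s); split; rewrite /= ?xs ?sk // => y.
  by rewrite inE => /predU1P[->|/sS].
have [[x0 _]|S0] := pselect (exists x, S x); last first.
  have -> : S = set0 by rewrite -subset0 => x Sx; apply: S0; exists x.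
  exact: card_ge0.
have image : S `<=` nth x0 s @` `I_(size s).
  by move=> x /sub xs; exists (index x s); rewrite /= ?index_mem ?nth_index.
apply: card_le_trans (subset_card_le image) _.
apply: card_le_trans (card_image_le _ _) _.
by rewrite card_le_II sk PN //; apply/asboolP; exists s.
Qed.

Theorem theorem7p1 (R : realType) (n : nat) (a b c : 'I_n -> R) (alpha : R)
    (n_ge1 : (1 <= n)%N)
    (b_neq0 : forall k : 'I_n, b k != 0)
    (alpha_lt : alpha < - (1 / 2))
    (f_neq0 : ~ (forall x : R, quadratic_power_sum a b c alpha x = 0)) :
  (critical_points (quadratic_power_sum a b c alpha) #<= `I_(4 * n - 2))%card.
Proof.
have al0 : alpha < 0 by lra.
(* As [n >= 1], the list [ts] has [(4 n - 2) + 1 = 4 n - 1] distinct critical points. *)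
apply: contrapT => /not_card_le_seq[ts [uts szts tsC]].
pose g := power_sum_coef a b c alpha 1.
have dense p q : p < q -> exists2 x, p < x < q & g x != 0.
  exact: power_sum_derivative_nonzero.
pose ss := sort <=%R ts.
have ssrt : sorted <%R ss by rewrite lt_sorted_uniq_le sort_uniq uts sort_le_sorted.
have gss t : t \in ss -> g t = 0.
  rewrite mem_sort => /tsC[_]; rewrite derive1E.
  have := @derive_val _ _ _ _ _ _ _ (is_derive_power_sum_coef a c alpha b_neq0 0 t).
  by rewrite power_sum_coef0 mul1r => ->.
have [s0 s0P gs0] : exists2 s0, path <%R s0 ss & g s0 != 0.
  case: (ss) ssrt => [|t u] /= tu.
    by have [x _ gx] := dense 0 1 ltr01; exists x.
  have [|x /andP[_ xt] gx] := dense (t - 1) t; first by rewrite ltrBlDr ltrDl.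
  by exists x; rewrite ?xt.
have [L1 [L2 [P1 P2 sz]]] := alternation_of_zeros dense s0P gs0 gss.
rewrite size_sort szts in sz.
pose k0 := Ordinal n_ge1.
pose h (x : R) := ((x - a k0) ^+ 2 + b k0 ^+ 2) `^ alpha.
have h0 x : 0 < h x.
  exact: powR_gt0 (pow_coef_base_gt0 (a k0) (b_neq0 k0) x).
(* For small [eps] the perturbation decides the sign only where [g] vanishes. *)
have near_eps : \forall eps \near 0^'+, forall x, x \in (s0 :: L1) ++ (s0 :: L2) ->
    g x != 0 -> eps * h x < `|g x|.
  apply: near_all_seq => x _; apply: near_zero_right.
  have [gx|gx] := eqVneq (g x) 0; first by exists 1 => // d _; rewrite gx eqxx.
  exists (`|g x| / (2 * h x)); first by rewrite divr_gt0 ?normr_gt0 // mulr_gt0.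
  move=> d /andP[_]; rewrite ler_pdivlMr ?mulr_gt0 // => dh _.
  have gx0 : 0 < `|g x| by rewrite normr_gt0.
  lra.
have [eps [heps eps0]] := filter_ex (filterI near_eps (nbhs_right_gt 0)).
have split_path (r : rel R) L : path (fun x y => (x < y) && r x y) s0 L ->
    sorted <%R (s0 :: L) /\ sorted r (s0 :: L).
  rewrite -[path _ _ _]/(path [rel x y | (x < y) && r x y] s0 L) path_relI => /andP[].
  by [].

have [[srt1 alt1] [srt2 alt2]] := (split_path _ _ P1, split_path _ _ P2).
have eh x : 0 < eps * h x by rewrite mulr_gt0.
(* Subtracting [eps * h] makes the zeros of [g] negative, which is the convention [0 < g] of [L1];
   adding it realises the convention [0 <= g] of [L2]. *)
have sgn1 x : x \in s0 :: L1 -> g x + - eps * h x != 0 /\ (0 < g x + - eps * h x) = (0 < g x).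
  move=> xL; have ehx := eh x; have [gx|gx] := eqVneq (g x) 0.
    rewrite gx add0r mulNr oppr_eq0 oppr_gt0 ltxx gt_eqF //; split => //.
    by apply/negbTE; rewrite -leNgt ltW.
  have := heps x _ gx; rewrite mem_cat xL => /(_ isT); rewrite ltr_normr mulNr => /orP[] h1.
    by split; [apply: lt0r_neq0|apply/idP/idP => _]; lra.
  by split; [apply: ltr0_neq0|apply/idP/idP => h3]; lra.
have sgn2 x : x \in s0 :: L2 -> g x + eps * h x != 0 /\ (0 < g x + eps * h x) = (0 <= g x).
  move=> xL; have ehx := eh x; have [gx|gx] := eqVneq (g x) 0.
    by rewrite gx add0r lexx ehx gt_eqF.
  have := heps x _ gx; rewrite mem_cat xL orbT => /(_ isT); rewrite ltr_normr => /orP[] h1.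
    by split; [apply: lt0r_neq0|apply/idP/idP => _]; lra.
  by split; [apply: ltr0_neq0|apply/idP/idP => h3]; lra.
have sz1 : (size (s0 :: L1) < 4 * n)%N.
  apply: (@perturbed_derivative_alternation R n a b c alpha b_neq0 al0 k0 (- eps)) => //.
    by move=> x /sgn1[].
  move: alt1; apply: (sub_in_sorted (P := mem (s0 :: L1))); last exact/allP.
  by move=> x y xL yL; rewrite -!/(h _) -!/(g _) (sgn1 x xL).2 (sgn1 y yL).2.
have sz2 : (size (s0 :: L2) < 4 * n)%N.
  apply: (@perturbed_derivative_alternation R n a b c alpha b_neq0 al0 k0 eps) => //.
    by move=> x /sgn2[].
  move: alt2; apply: (sub_in_sorted (P := mem (s0 :: L2))); last exact/allP.
  by move=> x y xL yL; rewrite -!/(h _) -!/(g _) (sgn2 x xL).2 (sgn2 y yL).2.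
(* The two bounds give [size L1 + size L2 <= 8 n - 4], whereas the [4 n - 1] zeros give
   [8 n - 2]. *)
have n1 := n_ge1; move: sz sz1 sz2 n1 => /=; clear; lia.
Qed.
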